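(* Assume the convex setting described in the context, and suppose that for each $\xi\in\Xi$, \[\operatorname{dom}f_\xi=\{x:c_k(x)\le\ell_k(\xi),\ k\in[m]\},\] where each $c_k:\mathbb{R}^n\to\mathbb{R}$ is convex and each $\ell_k$ is a real random variable on $\Xi$. Let $J=\{k\in[m]:\exists x\in\mathcal X^*,\ c_k(x)=(\ell_k)_0\}$. Suppose there is $\kappa:\Xi\to\mathbb{R}_+$ with $\mathbb{E}[\kappa(\xi)]=L$ such that $f_\xi$ is $\kappa(\xi)$-Lipschitz on $\operatorname{dom}f_\xi$ for every $\xi\in\Xi$, and that on every compact $X\subset\operatorname{dom}F$: (C1) for every $x\in X$, $\mathbb{E}[e^{t(f_\xi(x)-F(x))}]$ is finite for $t$ in a neighborhood of $0$; (C3) $\mathbb{E}[e^{t\kappa(\xi)}]$ is finite for $t$ in a neighborhood of $0$. Then there exist $\bar\alpha>0$ and positive constants $C,\beta$ (independent of $N$) such that for every $N\ge|J|$ and every $\alpha\in[0,\bar\alpha)$, \[\mathbb{P}^N\{d(x^*(\xi^{[N]}))<1-\alpha\}\le Ce^{-N\beta}+\sum_{k=0}^{|J|-1}\binom{N}{k}\alpha^k(1-\alpha)^{N-k}.\]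
   Context: Setting: $\mathcal{X}\subseteq\mathbb{R}^n$ is a nonempty closed convex set; $\xi$ is a random vector with support $\Xi$ and distribution $\mathbb P$; for each $\xi\in\Xi$, $f_\xi:\mathbb{R}^n\to\mathbb{R}\cup\{+\infty\}$ is convex; $F(x)=\mathbb{E}[f_\xi(x)]$, with $F>-\infty$ and $F(x)<+\infty$ for some $x\in\mathcal X$; $\operatorname{dom}F=\{x:F(x)<+\infty\}$; the optimal set $\mathcal X^*$ of $\inf_{x\in\mathcal X}F(x)$ is nonempty and compact. For $\beta\in[0,1)$, $(\ell_k)_\beta=\inf\{t\in\mathbb{R}:\mathbb P\{\ell_k\le t\}>\beta\}$; in particular $(\ell_k)_0$ is the essential infimum of $\ell_k$. $\xi^{[N]}$ is an i.i.d. sample of size $N$ with product measure $\mathbb P^N$, $\hat F_N(x)=\frac1N\sum_{i=1}^Nf_{\xi^i}(x)$, and $x^*(\xi^{[N]})$ is an optimal solution of $\inf_{x\in\mathcal X}\hat F_N(x)$ assigned to each sample. Degree of feasibility: $d(x^*(\xi^{[N]}))=\mathbb{P}\{\xi\in\Xi:f_\xi(x^*(\xi^{[N]}))<+\infty\}$. $[m]=\{1,\dots,m\}$. *)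

(* Defs.v *)
From HB Require Import structures.
From mathcomp Require Import all_boot all_order all_algebra.
From mathcomp Require Import all_classical all_reals all_analysis.
From mathcomp Require Import measurable_realfun.
Set Implicit Arguments. Unset Strict Implicit. Unset Printing Implicit Defensive.
Import Order.TTheory GRing.Theory Num.Theory.
Import numFieldNormedType.Exports.
Local Open Scope classical_set_scope.
Local Open Scope ring_scope.
Local Open Scope ereal_scope.

Section defs.
Context {R : realType} {d : measure_display} {T : measurableType d}.
Variable P : probability T R.

(** N-fold product probability P^N on samples (N-tuples), defined by
    iterated integration (the library has no N-fold product measure).
    P^0 is the Dirac mass at the empty tuple. *)
Fixpoint prodP (N : nat) : set (N.-tuple T) -> \bar R :=
  match N return set (N.-tuple T) -> \bar R with
  | 0%N => fun A => if `[< A [tuple] >] then 1 else 0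
  | N'.+1 => fun A => \int[P]_x @prodP N' [set t | A (cons_tuple x t)]
  end.

(** beta-quantile (l)_beta = inf { t in R : P{ l <= t } > beta } (in \bar R);
    (l)_0 is the essential infimum. *)
Definition quantile (l : T -> R) (beta : R) : \bar R :=
  ereal_inf [set t%:E | t in [set t : R | beta%:E < P [set xi | (l xi <= t)%R]]].

Context {n : nat}.

Definition expF (f : T -> 'rV[R]_n -> \bar R) (x : 'rV[R]_n) : \bar R :=
  \int[P]_xi f xi x.

Definition dfeas (f : T -> 'rV[R]_n -> \bar R) (x : 'rV[R]_n) : \bar R :=
  P [set xi | f xi x < +oo].

Definition hatF (f : T -> 'rV[R]_n -> \bar R) (N : nat) (s : N.-tuple T)
    (x : 'rV[R]_n) : \bar R :=
  (N%:R^-1)%:E * \sum_(i < N) f (tnth s i) x.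

End defs.

Definition argmin_on {R : realType} {n : nat} (X : set 'rV[R]_n)
    (g : 'rV[R]_n -> \bar R) : set 'rV[R]_n :=
  [set x | X x /\ forall y, X y -> g x <= g y].

(** convexity of an extended-real function with values in R U {+oo}
    (the -oo-freeness is stated separately):  for x, y in dom g and
    t in [0,1], g((1-t)x + t y) <= (1-t) g(x) + t g(y). *)
Definition ext_convex {R : realType} {n : nat} (g : 'rV[R]_n -> \bar R) :=
  forall (x y : 'rV[R]_n) (t : R), (0 <= t <= 1)%R ->
    g x < +oo -> g y < +oo ->
    g ((1 - t) *: x + t *: y)%R <= ((1 - t) * fine (g x) + t * fine (g y))%:E.

Definition Jset {R : realType} {d : measure_display} {T : measurableType d}
    (P : probability T R) {n m : nat} (Xstar : set 'rV[R]_n)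
    (c : 'I_m -> 'rV[R]_n -> R) (l : 'I_m -> T -> R) : {set 'I_m} :=
  [set k : 'I_m | `[< exists x, Xstar x /\ (c k x)%:E = quantile P (l k) 0 >]].

(* Main.v *)
(** The bad event has two sources.  First, [xstar] may leave a neighbourhood [W] of
    the optimal set on which the constraints outside [J] hold almost surely.  By
    convexity this forces a point [z] of a compact set [S], disjoint from the
    optimal set, that is feasible for the sample and no worse than an optimal
    [xb]; near each point of [S] this has exponentially small probability: either
    all samples of some [l_k] stay away from its essential infimum, or a Chernoff bound applies
    to [f_xi(xb) - f_xi(z) + delta * kappa], whose mean is negative.  Second, inside
    [W] only the constraints of [J] can be violated, and [c_k(xstar)] is at most every
    sampled [l_k], so [1 - d(xstar)] is at most the mass of the points beaten, for
    some [k] in [J], by the whole sample.  Sweeping the levels of the [l_k] one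
    coordinate after the other, as for order statistics, bounds the tail of this
    mass by that of the [#|J|]-th smallest of [N] uniform variables. *)

Require Import Defs.
From HB Require Import structures.
From mathcomp Require Import all_boot all_order all_algebra.
From mathcomp Require Import all_classical all_reals all_analysis.
From mathcomp Require Import measurable_realfun.
From mathcomp Require Import ring lra.
Import Order.TTheory GRing.Theory Num.Theory.
Import numFieldNormedType.Exports.
Set Implicit Arguments.
Unset Strict Implicit.
Local Open Scope classical_set_scope.
Local Open Scope ring_scope.
Local Open Scope ereal_scope.

(** * Monotonicity of the integral and measurability of Boolean predicates *)

Section integral_facts.
Context {R : realType} {d : measure_display} {T : measurableType d}.

Import HBNNSimple.

(** The integral of a nonnegative function is a supremum over the simple functions below it, and a
    larger function only enlarges that family. Arbitrary functions are allowed because [prodP] is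
    applied to arbitrary sets. *)
Lemma ge0_le_integral_nomeas (mu : {measure set T -> \bar R}) (f g : T -> \bar R) :
  (forall x, 0 <= f x) -> (forall x, f x <= g x) ->
  \int[mu]_x f x <= \int[mu]_x g x.
Proof.
move=> f0 fg; have g0 x : 0 <= g x := le_trans (f0 x) (fg x).
rewrite !ge0_integralTE//; apply: ereal_sup_le => _ [h /= hf <-].
by exists h => // x; exact: le_trans (hf x) (fg x).
Qed.

Lemma measurable_has_fun {I : Type} (F : I -> T -> bool) (r : seq I) :
  (forall i, measurable_fun setT (F i)) ->
  measurable_fun setT (fun y => has (F^~ y) r).
Proof.
move=> mF; elim: r => [|i r IH] /=; first exact: measurable_cst.
exact: measurable_or.
Qed.

Lemma measurable_all_fun {I : Type} (F : I -> T -> bool) (r : seq I) :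
  (forall i, measurable_fun setT (F i)) ->
  measurable_fun setT (fun y => all (F^~ y) r).
Proof.
move=> mF; elim: r => [|i r IH] /=; first exact: measurable_cst.
exact: measurable_and.
Qed.

Lemma measurable_predT (B : T -> bool) : measurable_fun setT B -> measurable [set x | B x].
Proof. by move=> mB; rewrite -[X in measurable X]setTI; exact: mB. Qed.

Lemma integral_pred (P : probability T R) (B : T -> bool) : measurable_fun setT B ->
  \int[P]_x (if B x then 1 else 0 : R)%:E = P [set x | B x].
Proof.
move=> mB; rewrite -[X in _ = P X]setIT -integral_indic//; last exact: measurable_predT.
apply: eq_integral => x _; rewrite indicE.
have -> : (x \in [set x | B x]) = B x by apply/idP/idP; rewrite inE.
by case: (B x).
Qed.

End integral_facts.

(** * Iterated integrals over samples drawn from a weighted measure *)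

Section weighted_product.
Context {R : realType} {d : measure_display} {T : measurableType d}.
Variable P : probability T R.
Implicit Types (w : T -> R) (g u : seq T -> \bar R).

(** Integral against the [N]-fold power of the measure with density [w]. Taking [g] on sequences
    rather than tuples lets points be removed from a sample without casts between sizes. *)
Fixpoint wint w (N : nat) g : \bar R :=
  if N is N'.+1 then \int[P]_x ((w x)%:E * wint w N' (fun s => g (x :: s)))
  else g [::].

Definition seq_measurable g :=
  forall N, measurable_fun setT (fun t : N.-tuple T => g t).

Lemma seq_measurable_cons g x :
  seq_measurable g -> seq_measurable (fun s => g (x :: s)).
Proof.
move=> mg N.
apply: (@measurableT_comp _ _ _ _ _ _ (fun t : N.+1.-tuple T => g t) _
  (fun t : N.-tuple T => [tuple of x :: t])); first exact: mg.
exact: measurable_cons.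
Qed.

Lemma wint_ge0 w N g : (forall x, (0 <= w x)%R) -> (forall s, 0 <= g s) ->
  0 <= wint w N g.
Proof.
move=> w0; elim: N g => [|N IH] g g0 //=.
by apply: integral_ge0 => x _; rewrite mule_ge0 ?lee_fin ?IH.
Qed.

Lemma le_wint w N g u : (forall x, (0 <= w x)%R) -> (forall s, 0 <= g s) ->
  (forall s, size s = N -> g s <= u s) -> wint w N g <= wint w N u.
Proof.
move=> w0; elim: N g u => [|N IH] g u g0 gu /=; first exact: gu.
apply: ge0_le_integral_nomeas => x; first by rewrite mule_ge0 ?lee_fin ?wint_ge0.
by rewrite lee_wpmul2l ?lee_fin ?IH// => s sN; rewrite gu//= sN.
Qed.

(** The parameter space must vary in the induction: the first sample point joins the parameter, [Y]
    becomes [Y * T], and Tonelli's theorem then integrates that point out. *)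
Lemma measurable_wint_param w N : measurable_fun setT w ->
  (forall x, (0 <= w x)%R) ->
  forall d' (Y : measurableType d') (G : Y -> seq T -> \bar R),
  (forall y s, 0 <= G y s) ->
  measurable_fun setT (fun p : Y * N.-tuple T => G p.1 p.2) ->
  measurable_fun setT (fun y => wint w N (G y)).
Proof.
move=> mw w0; elim: N => [|N IH] d' Y G G0 mG /=.
  have mp : measurable_fun setT (fun y : Y => (y, [tuple] : 0.-tuple T)).
    exact: measurable_fun_pair.
  exact: (measurableT_comp mG mp).
pose H (p : Y * T) := (w p.2)%:E * wint w N (fun s => G p.1 (p.2 :: s)).
have mH : measurable_fun setT H.
  apply: emeasurable_funM.
    by apply/measurable_EFinP; exact: measurableT_comp.
  apply: (IH _ _ (fun p s => G p.1 (p.2 :: s))) => //=.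
  have mp : measurable_fun setT
      (fun p : (Y * T) * N.-tuple T => (p.1.1, [tuple of p.1.2 :: p.2])).
    apply: measurable_fun_pair; first exact: measurableT_comp.
    by apply: measurable_cons => //; exact: measurableT_comp.
  exact: (measurableT_comp mG mp).
apply: (@measurable_fun_fubini_tonelli_F _ _ _ _ _ P H) => // p.
by rewrite mule_ge0 ?lee_fin ?wint_ge0.
Qed.

Lemma measurable_wint_cons w N g : measurable_fun setT w ->
  (forall x, (0 <= w x)%R) -> (forall s, 0 <= g s) -> seq_measurable g ->
  measurable_fun setT (fun x => wint w N (fun s => g (x :: s))).
Proof.
move=> mw w0 g0 mg.
apply: (@measurable_wint_param w N mw w0 _ _ (fun x s => g (x :: s))) => //=.
apply: (@measurableT_comp _ _ _ _ _ _ (fun t : N.+1.-tuple T => g t) _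
    (fun p : T * N.-tuple T => [tuple of p.1 :: p.2])); first exact: mg.
exact: measurable_cons.
Qed.

Lemma wintD w N g u : measurable_fun setT w -> (forall x, (0 <= w x)%R) ->
  (forall s, 0 <= g s) -> (forall s, 0 <= u s) ->
  seq_measurable g -> seq_measurable u ->
  wint w N (fun s => g s + u s) = wint w N g + wint w N u.
Proof.
move=> mw w0; elim: N g u => [|N IH] g u g0 u0 mg mu //=.
rewrite -ge0_integralD//=.
- apply: eq_integral => x _.
  rewrite (IH (fun s => g (x :: s)) (fun s => u (x :: s)))//; first last.
  + exact: seq_measurable_cons.
  + exact: seq_measurable_cons.
  by rewrite ge0_muleDr ?wint_ge0.
- by move=> x _; rewrite mule_ge0 ?lee_fin ?wint_ge0.
- by apply: emeasurable_funM; [exact/measurable_EFinP|exact: measurable_wint_cons].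
- by move=> x _; rewrite mule_ge0 ?lee_fin ?wint_ge0.
- by apply: emeasurable_funM; [exact/measurable_EFinP|exact: measurable_wint_cons].
Qed.

Lemma wint_cst1 w N (b : R) : measurable_fun setT w -> (forall x, (0 <= w x)%R) ->
  \int[P]_x (w x)%:E = b%:E -> wint w N (fun=> 1) = (b ^+ N)%:E.
Proof.
move=> mw w0 wb; elim: N => [|N IH] //=.
rewrite ge0_integralZr//=; first by rewrite wb IH -EFinM exprS.
- exact/measurable_EFinP.
- by move=> x _; rewrite lee_fin.
- exact: wint_ge0.
Qed.

Lemma wint_prod (w : T -> R) N : (forall x, (0 <= w x)%R) -> measurable_fun setT w ->
  wint (fun=> 1%R) N (fun s => (\prod_(x <- s) w x)%:E) = wint w N (fun=> 1).
Proof.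
move=> w0 mw; have prod0 s : (0 <= \prod_(x <- s) w x)%R by exact: prodr_ge0.
(* [c] accumulates the factors of the points already integrated. *)
suff H (c : R) : (0 <= c)%R ->
  wint (fun=> 1%R) N (fun s => (c * \prod_(x <- s) w x)%:E) = c%:E * wint w N (fun=> 1).
  by rewrite -[RHS]mul1e -H//; congr wint; apply/funext => s; rewrite mul1r.
elim: N c => [|N IH] c c0 /=; first by rewrite big_nil mulr1 mule1.
rewrite -ge0_integralZl//; first last.
- by move=> x _; rewrite mule_ge0 ?lee_fin ?wint_ge0.
- apply: emeasurable_funM => //; exact/measurable_EFinP.
apply: eq_integral => x _; rewrite mul1e muleA -EFinM -IH ?mulr_ge0//.
by congr wint; apply/funext => s; rewrite big_cons mulrA.
Qed.

(* Expands the product weight into the terms with at most one factor [nu]: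
   a sample point charged by [nu] is removed at the cost of replacing [g] by [u]. *)
Lemma wint_split (nu rho : T -> R) (c : R) N g g' u :
  measurable_fun setT nu -> measurable_fun setT rho ->
  (forall x, (0 <= nu x)%R) -> (forall x, (0 <= rho x)%R) ->
  \int[P]_x (nu x)%:E = c%:E ->
  (forall s, 0 <= g s) -> (forall s, 0 <= g' s) -> (forall s, 0 <= u s) ->
  seq_measurable g -> seq_measurable g' -> seq_measurable u ->
  (forall s, g s <= g' s) ->
  (forall s1 x s2, nu x != 0%R -> g (s1 ++ x :: s2) <= u (s1 ++ s2)) ->
  wint (fun x => nu x + rho x)%R N g <=
  wint rho N g' + (N%:R * c)%:E * wint (fun x => nu x + rho x)%R N.-1 u.
Proof.
move=> mnu mrho nu0 rho0 nuc.
pose w x := (nu x + rho x)%R; rewrite -/w.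
have w0 x : (0 <= w x)%R by rewrite addr_ge0.
have mw : measurable_fun setT w by exact: measurable_funD.
have c0 : (0 <= c)%R by rewrite -lee_fin -nuc integral_ge0// => x _; rewrite lee_fin.
have mM (v : T -> R) k h : (forall x, (0 <= v x)%R) -> measurable_fun setT v ->
    (forall s, 0 <= h s) -> seq_measurable h -> forall v' : T -> R, measurable_fun setT v' ->
    measurable_fun setT (fun x => (v' x)%:E * wint v k (fun s => h (x :: s))).
  move=> v0 mv h0 mh v' mv'.
  by apply: emeasurable_funM; [exact/measurable_EFinP|exact: measurable_wint_cons].
elim: N g g' u => [|N IH] g g' u g0 g'0 u0 mg mg' mu gg' gu.
  by rewrite /= mul0r mul0e adde0.
have pos (v : T -> R) k h x : (forall x, (0 <= v x)%R) -> (forall s, 0 <= h s) ->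
    forall r : R, (0 <= r)%R -> 0 <= r%:E * wint v k (fun s => h (x :: s)).
  by move=> v0 h0 r r0; rewrite mule_ge0 ?lee_fin ?wint_ge0.
rewrite [X in X <= _]/= [X in _ <= X + _]/= [N.+1.-1]/=.
under eq_integral do rewrite EFinD ge0_muleDl ?lee_fin ?wint_ge0//.
rewrite ge0_integralD//=; first last.
- exact: mM.
- by move=> x _; exact: pos.
- exact: mM.
- by move=> x _; exact: pos.
(* The [N + 1] possible positions of a point charged by [nu] are the head and the [N] positions of
   the tail; the head is treated directly, the tail by induction. *)
have -> : (N.+1%:R * c)%:E * wint w N u = c%:E * wint w N u + (N%:R * c)%:E * wint w N u.
  by rewrite -ge0_muleDl ?lee_fin ?mulr_ge0// -EFinD; congr (_%:E * _); rewrite -nat1r; ring.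
rewrite [leRHS]addeCA leeD//.
  rewrite -nuc -ge0_integralZr//=.
  - apply: ge0_le_integral_nomeas => x; first exact: pos.
    have [->|nux] := eqVneq (nu x) 0%R; first by rewrite !mul0e.
    rewrite lee_wpmul2l ?lee_fin// le_wint// => s _.
    exact: (gu [::]).
  - exact/measurable_EFinP.
  - by move=> x _; rewrite lee_fin.
  - exact: wint_ge0.
have IHx x : wint w N (fun s => g (x :: s)) <= wint rho N (fun s => g' (x :: s)) +
    (N%:R * c)%:E * wint w N.-1 (fun s => u (x :: s)).
  apply: IH => //; try exact: seq_measurable_cons.
  by move=> s1 y s2 nuy; exact: (gu (x :: s1)).
apply: (@le_trans _ _ (\int[P]_x ((rho x)%:E * wint rho N (fun s => g' (x :: s)) +
   (N%:R * c)%:E * ((rho x)%:E * wint w N.-1 (fun s => u (x :: s)))))).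
  apply: ge0_le_integral_nomeas => x; first exact: pos.
  rewrite muleCA -ge0_muleDr ?wint_ge0 ?mule_ge0 ?lee_fin ?mulr_ge0 ?wint_ge0//.
  by rewrite lee_wpmul2l ?lee_fin.
rewrite ge0_integralD//=; first last.
- apply: emeasurable_funM => //; exact: mM.
- by move=> x _; rewrite mule_ge0 ?lee_fin ?mulr_ge0 ?pos.
- exact: mM.
- by move=> x _; exact: pos.
rewrite leeD2l// ge0_integralZl//=; first last.
- by rewrite lee_fin mulr_ge0.
- by move=> x _; exact: pos.
- exact: mM.
(* For [N = 0] the truncated predecessor is harmless, since the factor [N * c] vanishes. *)
case: N IHx {IH} => [|N] _; first by rewrite mul0r !mul0e.
rewrite lee_wpmul2l ?lee_fin ?mulr_ge0//=.
apply: ge0_le_integral_nomeas => x; first exact: pos.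
by rewrite lee_wpmul2r ?wint_ge0// lee_fin lerDr.
Qed.

End weighted_product.

Lemma near_natSinv_lt {R : realType} (e : R) : (0 < e)%R ->
  \forall n \near \oo, (n.+1%:R^-1 < e)%R.
Proof. by move=> e0; exact: (near_infty_natSinv_lt (PosNum e0)). Qed.

(** * Splitting a weight at a quantile of a random level *)

Section mass.
Context {R : realType} {d : measure_display} {T : measurableType d}.
Variable P : probability T R.
Variable rho : T -> R.
Hypothesis mrho : measurable_fun setT rho.
Hypothesis rho0 : forall x, (0 <= rho x)%R.
Variable b : R.
Hypothesis rhob : \int[P]_x (rho x)%:E = b%:E.

Let cut (A : T -> bool) x : R := if A x then rho x else 0%R.

Let mcut (A : T -> bool) : measurable_fun setT A -> measurable_fun setT (cut A).
Proof. by move=> mA; apply: measurable_fun_ifT => //; exact: measurable_cst. Qed.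

Let cut0 A x : (0 <= cut A x)%R. Proof. by rewrite /cut; case: ifP. Qed.

Let irho : P.-integrable setT (fun x => (rho x)%:E).
Proof.
apply/integrableP; split; first exact/measurable_EFinP.
under eq_integral do rewrite /= ger0_norm//.
by rewrite rhob ltry.
Qed.

Let m (A : T -> bool) : R := fine (\int[P]_x (cut A x)%:E).

Let mE (A : T -> bool) : \int[P]_x (cut A x)%:E = (m A)%:E.
Proof.
rewrite /m fineK// ge0_fin_numE; last first.
  by apply: integral_ge0 => x _; rewrite lee_fin.
rewrite (@le_lt_trans _ _ (b%:E))// ?ltry// -rhob.
apply: ge0_le_integral_nomeas => x; rewrite lee_fin//.
by rewrite /cut; case: ifP.
Qed.

Let le_m (A B : T -> bool) : (forall x, A x -> B x) -> (m A <= m B)%R.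
Proof.
move=> AB; rewrite -lee_fin -!mE//.
apply: ge0_le_integral_nomeas => x; rewrite lee_fin// /cut.
by case: ifP => [/AB ->//|_]; case: ifP.
Qed.

Let m_cvg (A : nat -> T -> bool) (B : T -> bool) :
  (forall n, measurable_fun setT (A n)) -> measurable_fun setT B ->
  (forall x, \forall n \near \oo, A n x = B x) -> m (A n) @[n --> \oo] --> m B.
Proof.
move=> mA mB AB.
have [| | | | |_ _] := @dominated_convergence _ _ _ P _ measurableT
  (fun n x => (cut (A n) x)%:E) (fun x => (cut B x)%:E) (fun x => (rho x)%:E).
- by move=> n; apply/measurable_EFinP; exact: mcut.
- by apply/measurable_EFinP; exact: mcut.
- apply: aeW => x _; apply: cvg_near_cst.
  by apply: filterS (AB x) => n; rewrite /cut => ->.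
- exact: irho.
- apply: aeW => x n _ /=; rewrite ger0_norm// lee_fin /cut; by case: ifP.
under eq_fun do rewrite mE.
by rewrite mE => /fine_cvgP[].
Qed.

Variables (h : R) (h0 : (0 < h)%R) (hb : (h < b)%R).
Variables (l : T -> R) (ml : measurable_fun setT l).

Let mlt t : measurable_fun setT (fun x => l x < t)%R.
Proof. by apply: measurable_fun_ltr => //; exact: measurable_cst. Qed.

Let mle t : measurable_fun setT (fun x => l x <= t)%R.
Proof. by apply: measurable_fun_ler => //; exact: measurable_cst. Qed.

(** [t] is the infimum of the levels whose closed sublevel has mass above [h], finite because
    [0 < h < b]. Dominated convergence from the left and from the right of [t] gives the two
    inequalities. *)
Let quantile_ex : exists t, (m (fun x => l x < t)%R <= h <= m (fun x => l x <= t)%R)%R.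
Proof.
pose A := [set t | (h < m (fun x => l x <= t))%R].
have mb : m xpredT = b.
  by rewrite /m /cut /= rhob.
have m0 : m xpred0 = 0%R.
  by rewrite /m /cut /= integral0.
have A0 : A !=set0.
  have /cvgr_gt : m (fun x => l x <= n%:R)%R @[n --> \oo] --> b.
    rewrite -mb; apply: m_cvg => // x.
    near=> n; apply/idP; near: n; exact: nbhs_infty_ger.
  move=> /(_ _ hb)[N _ /(_ N (leqnn N)) AN].
  by exists N%:R.
have lbA : has_lbound A.
  have /cvgr_lt : m (fun x => l x <= - n%:R)%R @[n --> \oo] --> 0%R.
    rewrite -m0; apply: m_cvg => // x.
    near=> n; apply/negbTE; rewrite -ltNge ltrNl; near: n; exact: nbhs_infty_gtr.
  move=> /(_ _ h0)[N _ /(_ N (leqnn N)) AN].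
  exists (- N%:R)%R => t /= ht; rewrite leNgt; apply/negP => tN.
  have : (m (fun x => l x <= t) <= m (fun x => l x <= - N%:R))%R.
    by apply: le_m => x /le_trans; apply; exact: ltW.
  by rewrite leNgt (lt_trans AN).
have hinf : has_inf A by split.
exists (inf A); apply/andP; split.
- have cv : m (fun x => l x <= inf A - n.+1%:R^-1)%R @[n --> \oo] --> m (fun x => l x < inf A)%R.
    apply: m_cvg => // x; have [xA|xA] := ltP (l x) (inf A).
      near=> n; rewrite lerBrDr -lerBrDl ltW//.
      by near: n; apply: near_natSinv_lt; rewrite subr_gt0.
    near=> n; apply/negbTE; rewrite -ltNge (lt_le_trans _ xA)// ltrBlDr ltrDl.
    by rewrite invr_gt0.
  rewrite leNgt; apply/negP => hm.
  move/cvgr_gt : cv => /(_ _ hm)[N _ /(_ N (leqnn N))] hN.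
  have /(_ (inf A - N.+1%:R^-1))%R := inf_lbound lbA => /(_ hN).
  by rewrite leNgt ltrBlDr ltrDl invr_gt0 ltr0n.
have cv : m (fun x => l x <= inf A + n.+1%:R^-1)%R @[n --> \oo] --> m (fun x => l x <= inf A)%R.
  apply: m_cvg => // x; have [xA|xA] := leP (l x) (inf A).
    by near=> n; rewrite (le_trans xA)// lerDl.
  near=> n; apply/negbTE; rewrite -ltNge -ltrBrDl.
  by near: n; apply: near_natSinv_lt; rewrite subr_gt0.
rewrite leNgt; apply/negP => hm.
move/cvgr_lt : cv => /(_ _ hm)[N _ /(_ N (leqnn N))] hN.
have e0 : (0 < N.+1%:R^-1 :> R)%R by rewrite invr_gt0.
have [t At tA] := inf_adherent e0 hinf.
have : (m (fun x => l x <= t) <= m (fun x => l x <= inf A + N.+1%:R^-1))%R.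
  by apply: le_m => x /le_trans; apply; exact: ltW.
by rewrite leNgt (lt_trans hN).
Unshelve. all: by end_near. Qed.

(* The atom [l = t], if any, is shared between the two parts. *)
Lemma split_weight : exists nu rho' : T -> R, exists t : R,
  [/\ measurable_fun setT nu, measurable_fun setT rho',
      forall x, (0 <= nu x)%R, forall x, (0 <= rho' x)%R &
      rho = (fun x => nu x + rho' x)%R] /\
  [/\ \int[P]_x (nu x)%:E = h%:E, \int[P]_x (rho' x)%:E = (b - h)%:E,
      forall x, nu x != 0%R -> (l x <= t)%R &
      forall x, rho' x != 0%R -> (t <= l x)%R].
Proof.
have [t /andP[th ht]] := quantile_ex.
pose p := m (fun x => l x == t).
have meq : measurable_fun setT (fun x => l x == t).
  by apply: measurable_fun_eqr => //; exact: measurable_cst.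
have mle_eq : m (fun x => l x <= t)%R = (m (fun x => l x < t)%R + p)%R.
  apply: EFin_inj; rewrite EFinD -!mE -ge0_integralD//.
  - apply: eq_integral => x _; rewrite -EFinD /cut; congr EFin.
    by case: ltgtP; rewrite ?addr0 ?add0r.
  - by move=> x _; rewrite lee_fin.
  - by apply/measurable_EFinP; exact: mcut.
  - by move=> x _; rewrite lee_fin.
  - by apply/measurable_EFinP; exact: mcut.
have p0 : (0 <= p)%R.
  by apply/fine_ge0/integral_ge0 => x _; rewrite lee_fin.
rewrite mle_eq in ht.
(* [c] is the fraction of the atom given to [nu]. If [p = 0] the division returns [0], and the
   quantile inequalities already force the open sublevel to have mass [h]. *)
pose c := ((h - m (fun x => l x < t)%R) / p)%R.
have cp : (m (fun x => l x < t) + c * p = h)%R.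
  have [pE|pN] := eqVneq p 0%R; last by rewrite /c divfK// addrC subrK.
  by apply/eqP; rewrite eq_le pE mulr0 addr0 th -[leRHS]addr0 -pE ht.
have c0 : (0 <= c)%R by rewrite divr_ge0// subr_ge0.
have c1 : (c <= 1)%R.
  have [pE|pN] := eqVneq p 0%R; first by rewrite /c pE invr0 mulr0.
  by rewrite ler_pdivrMr ?lt0r ?pN// mul1r lerBlDl.
pose nu x := (cut (fun x => l x < t) x + c * cut (fun x => l x == t) x)%R.
pose rho' x := (cut (fun x => t < l x) x + (1 - c) * cut (fun x => l x == t) x)%R.
have rhoE x : rho x = (nu x + rho' x)%R.
  by rewrite /nu /rho' /cut; case: ltgtP => _; ring.
have mnu : measurable_fun setT nu.
  apply: measurable_funD; first exact: mcut.
  by apply: measurable_funM; [exact: measurable_cst|exact: mcut].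
have mrho' : measurable_fun setT rho'.
  apply: measurable_funD.
    by apply: mcut; apply: measurable_fun_ltr => //; exact: measurable_cst.
  by apply: measurable_funM; [exact: measurable_cst|exact: mcut].
have nu0 x : (0 <= nu x)%R by rewrite /nu addr_ge0 ?cut0// mulr_ge0 ?cut0.
have rho'0 x : (0 <= rho' x)%R by rewrite /rho' addr_ge0 ?cut0// mulr_ge0 ?cut0// subr_ge0.
have nuh : \int[P]_x (nu x)%:E = h%:E.
  under eq_integral do rewrite EFinD EFinM.
  rewrite ge0_integralD//=.
  - rewrite ge0_integralZl//=; first by rewrite !mE -/p -EFinM -EFinD cp.
    + by apply/measurable_EFinP; exact: mcut.
    + by move=> x _; rewrite lee_fin.
  - by move=> x _; rewrite lee_fin.
  - by apply/measurable_EFinP; exact: mcut.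
  - by move=> x _; rewrite -EFinM lee_fin mulr_ge0 ?cut0.
  - apply/measurable_EFinP; apply: measurable_funM; first exact: measurable_cst.
    exact: mcut.
exists nu, rho', t; split; [split => //; exact/funext|split => //].
- have : \int[P]_x (nu x)%:E + \int[P]_x (rho' x)%:E = b%:E.
    rewrite -rhob -ge0_integralD//.
    + by apply: eq_integral => x _; rewrite -EFinD -rhoE.
    + by move=> x _; rewrite lee_fin.
    + exact/measurable_EFinP.
    + by move=> x _; rewrite lee_fin.
    + exact/measurable_EFinP.
  rewrite nuh; case: (\int[P]_x (rho' x)%:E) => //= r.
  by rewrite -EFinD => -[<-]; rewrite addrC addKr.
- by move=> x; rewrite /nu /cut; case: ltgtP => //; rewrite mulr0 addr0 eqxx.
- by move=> x; rewrite /rho' /cut; case: ltgtP => //; rewrite mulr0 addr0 eqxx.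
Qed.

End mass.

(** * Tail bound for the mass beaten by a whole sample *)

Section scenario.
Context {R : realType} {d : measure_display} {T : measurableType d}.
Variable P : probability T R.
Context {I : Type} (l : I -> T -> R).
Hypothesis ml : forall k, measurable_fun setT (l k).

(** A decision feasible for the sample has [c k] at most every sampled [l k], so a new point at
    which it breaks constraint [k] lies strictly below all sampled levels. The predicate records
    this without mentioning the decision. *)
Definition violated (ks : seq I) (s : seq T) (x : T) : bool :=
  has (fun k => all (fun z => l k x < l k z)%R s) ks.

Definition viol (rho : T -> R) ks s : \bar R :=
  \int[P]_x (if violated ks s x then rho x else 0%R)%:E.

Definition viol_gt rho ks (a : R) s : \bar R :=
  if a%:E < viol rho ks s then 1 else 0.

Lemma viol_gt_ge0 rho ks a s : 0 <= viol_gt rho ks a s.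
Proof. by rewrite /viol_gt; case: ifP. Qed.

Lemma viol_gt_le1 rho ks a s : viol_gt rho ks a s <= 1.
Proof. by rewrite /viol_gt; case: ifP. Qed.

Lemma measurable_violated ks N :
  measurable_fun setT (fun p : N.-tuple T * T => violated ks p.1 p.2).
Proof.
rewrite /violated; apply: (@measurable_has_fun _ _ _ (fun k (p : N.-tuple T * T) =>
  all (fun z => l k p.2 < l k z)%R p.1)) => k.
rewrite (_ : (fun _ => _) = (fun p : N.-tuple T * T =>
    all (fun i => l k p.2 < l k (tnth p.1 i))%R (enum 'I_N))).
  apply: (@measurable_all_fun _ _ _ (fun i (p : N.-tuple T * T) =>
    l k p.2 < l k (tnth p.1 i))%R) => i.
  apply: measurable_fun_ltr; first exact: measurableT_comp.
  apply: measurableT_comp => //.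
  exact: (measurableT_comp (measurable_tnth i)).
apply/funext => p; rewrite -[in LHS](map_tnth_enum p.1) all_map.
exact: eq_all.
Qed.

Lemma measurable_violated_seq ks s : measurable_fun setT (violated ks s).
Proof.
apply: (@measurable_has_fun _ _ _ (fun k x => all (fun z => l k x < l k z)%R s)) => k.
apply: (@measurable_all_fun _ _ _ (fun z x => l k x < l k z)%R) => z.
by apply: measurable_fun_ltr => //; exact: measurable_cst.
Qed.

Lemma seq_measurable_viol (rho : T -> R) ks : measurable_fun setT rho ->
  (forall x, (0 <= rho x)%R) -> seq_measurable (viol rho ks).
Proof.
move=> mrho rho0 N.
apply: (@measurable_fun_fubini_tonelli_F _ _ _ _ _ P
  (fun p : N.-tuple T * T => (if violated ks p.1 p.2 then rho p.2 else 0%R)%:E)) => //.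
  apply/measurable_EFinP; apply: measurable_fun_ifT => //.
  - exact: measurable_violated.
  - exact: measurableT_comp.
by move=> p; rewrite lee_fin; case: ifP.
Qed.

Lemma seq_measurable_viol_gt (rho : T -> R) ks a : measurable_fun setT rho ->
  (forall x, (0 <= rho x)%R) -> seq_measurable (viol_gt rho ks a).
Proof.
move=> mrho rho0 N; apply: measurable_fun_ifT => //.
apply: measurable_fun_lte => //; exact: seq_measurable_viol.
Qed.

(** For [b = 1] and [a] in [0,1], the probability that fewer than [q] of [N] independent uniform
    variables fall below [a]; for general [b], Lebesgue measure on [0,b] replaces the uniform
    law. *)
Definition binomial_tail q N (a b : R) : R :=
  (\sum_(0 <= k < q) 'C(N, k)%:R * a ^+ k * (b - a) ^+ (N - k))%R.

Lemma le_wint_viol_gt (rho : T -> R) ks N a b : measurable_fun setT rho ->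
  (forall x, (0 <= rho x)%R) -> \int[P]_x (rho x)%:E = b%:E ->
  wint P rho N (viol_gt rho ks a) <= (b ^+ N)%:E.
Proof.
move=> mrho rho0 rhob; rewrite -(wint_cst1 N mrho rho0 rhob).
by apply: le_wint => // *; [exact: viol_gt_ge0|exact: viol_gt_le1].
Qed.

Let mif (rho : T -> R) ks s : measurable_fun setT rho ->
  measurable_fun setT (fun x => (if violated ks s x then rho x else 0%R)%:E).
Proof.
move=> mrho; apply/measurable_EFinP; apply: measurable_fun_ifT => //.
exact: measurable_violated_seq.
Qed.

(* [rho'] is [rho] minus the mass [h] carried by the lowest levels of [l k].  Either
   no sample point lies in the swept part, or one does, and then [k] plays no further
   role: no point charged by [rho'] lies below that sample point. *)
Lemma sweep_step (rho : T -> R) k ks N (a b h : R) : measurable_fun setT rho ->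
  (forall x, (0 <= rho x)%R) -> \int[P]_x (rho x)%:E = b%:E ->
  (0 < h)%R -> (h < b)%R ->
  exists rho' : T -> R, [/\ measurable_fun setT rho', forall x, (0 <= rho' x)%R,
    \int[P]_x (rho' x)%:E = (b - h)%:E &
    wint P rho N (viol_gt rho (k :: ks) a) <=
    wint P rho' N (viol_gt rho' (k :: ks) (a - h)) +
    (N%:R * h)%:E * wint P rho N.-1 (viol_gt rho ks (a - h))].
Proof.
move=> mrho rho0 rhob h0 hb.
have [nu [rho' [t [[mnu mrho' nu0 rho'0 rhoE] [nuh rho'b nut rho't]]]]] :=
  split_weight mrho rho0 rhob h0 hb (ml k).
exists rho'; split => //.
have gtE (r r' : T -> R) ls ls' s s' :
    measurable_fun setT r' -> (forall x, (0 <= r' x)%R) ->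
    (forall x, (0 <= r x)%R) ->
    (forall x, (if violated ls s x then r x else 0) <=
              nu x + (if violated ls' s' x then r' x else 0))%R ->
    viol_gt r ls a s <= viol_gt r' ls' (a - h) s'.
  move=> mr' r'0 r0 H; rewrite /viol_gt.
  case: ifPn => [av|_]; last by case: ifP.
  (* The violated mass drops by at most the mass [h] of [nu], and the threshold drops by [h] as
     well. *)
  suff -> : (a - h)%:E < viol r' ls' s' by [].
  rewrite EFinB lteBlDr// (lt_le_trans av)// addeC -nuh /viol -ge0_integralD//.
  - apply: ge0_le_integral_nomeas => x; first by rewrite lee_fin; case: ifP.
    by rewrite -EFinD lee_fin.
  - by move=> x _; rewrite lee_fin.
  - exact/measurable_EFinP.
  - by move=> x _; rewrite lee_fin; case: ifP.
  - exact: mif.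
rewrite [in X in X <= _]rhoE [in X in _ <= _ + _ * X]rhoE.
apply: wint_split => //; try (by move=> s; exact: viol_gt_ge0).
- by apply: seq_measurable_viol_gt; [exact: measurable_funD|move=> x; rewrite addr_ge0].
- exact: seq_measurable_viol_gt.
- by apply: seq_measurable_viol_gt; [exact: measurable_funD|move=> x; rewrite addr_ge0].
- move=> s; apply: gtE => //; first by move=> x; rewrite addr_ge0.
  by move=> x; case: ifP; rewrite // addr0.
move=> s1 z s2 nuz; rewrite -rhoE; apply: gtE => // x.
case: ifPn => [|_]; last by rewrite addr_ge0//; case: ifP.
have [rho'x|rho'x] := eqVneq (rho' x) 0%R.
  by move=> _; rewrite {1}rhoE rho'x addr0 lerDl; case: ifP.
rewrite /violated /= => /orP[|].
  rewrite all_cat /= => /and3P[_ lxz _].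
  by have := le_lt_trans (rho't x rho'x) lxz; rewrite ltNge nut.
move=> Hks; rewrite ifT ?lerDr//.
apply: sub_has Hks => k' /=; rewrite !all_cat /=.
by move=> /and3P[-> _ ->].
Qed.

(** A left Riemann sum of an increasing function stays below the integral; here by telescoping
    differences of successive powers. *)
Lemma sum_expr_le (K k : nat) :
  (\sum_(0 <= i < K) k.+1%:R * i%:R ^+ k <= K%:R ^+ k.+1 :> R)%R.
Proof.
elim: K => [|K IH]; first by rewrite big_geq// exprn_ge0.
rewrite big_nat_recr//= (le_trans (lerD IH (lexx _)))//.
rewrite -lerBrDl subrXX -natrB// subSnn mul1r.
rewrite (_ : k.+1%:R * _ = \sum_(i < k.+1) K%:R ^+ k)%R; last first.
  by rewrite sumr_const card_ord mulr_natl.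
apply: ler_sum => i _ /=.
have ik : (i <= k)%N by rewrite -ltnS.
rewrite -{1}(subnK ik) exprD ler_wpM2r ?exprn_ge0//.
by rewrite lerXn2r ?nnegrE// ler_nat.
Qed.

(** Induction on the number [K] of sweeps still to do: each removes [h] from both weight and
    threshold, and pays one term in which [k] has been discarded. At threshold [0] the trivial bound
    by the total mass gives [e ^+ N]. *)
Lemma sweep_iter ks N (e h : R) : (0 < h)%R -> (0 < e)%R ->
  (forall (rho : T -> R) M a b, measurable_fun setT rho ->
    (forall x, (0 <= rho x)%R) -> \int[P]_x (rho x)%:E = b%:E ->
    (0 <= a < b)%R ->
    wint P rho M (viol_gt rho ks a) <= (binomial_tail (size ks) M a b)%:E) ->
  forall k K (rho : T -> R), measurable_fun setT rho ->
    (forall x, (0 <= rho x)%R) -> \int[P]_x (rho x)%:E = (e + K%:R * h)%:E ->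
  wint P rho N (viol_gt rho (k :: ks) (K%:R * h)) <=
  (e ^+ N + \sum_(0 <= i < K) N%:R * h *
     binomial_tail (size ks) N.-1 (i%:R * h) (e + h + i%:R * h))%:E.
Proof.
move=> h0 e0 IHks k; elim=> [|K IH] rho mrho rho0 rhob.
  rewrite big_geq// addr0; apply: le_wint_viol_gt => //.
  by rewrite rhob mul0r addr0.
have hb : (h < e + K.+1%:R * h)%R.
  rewrite -nat1r mulrDl mul1r addrCA ltrDl ltr_wpDr// mulr_ge0//; exact: ltW.
have [rho' [mrho' rho'0 rho'b]] := sweep_step k ks N (K.+1%:R * h) mrho rho0 rhob h0 hb.
have aE : (K.+1%:R * h - h = K%:R * h)%R by rewrite -nat1r; ring.
rewrite aE => /le_trans; apply.
rewrite big_nat_recr//= addrA EFinD leeD//.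
  by apply: IH => //; rewrite rho'b -nat1r; congr EFin; ring.
rewrite [leRHS]EFinM; apply: lee_wpmul2l; first by rewrite lee_fin mulr_ge0// ltW.
apply: IHks => //; first by rewrite rhob -nat1r; congr EFin; ring.
by rewrite mulr_ge0 ?ltrDr ?addr_gt0//= ltW.
Qed.

(** The mass [a] is swept along the head index in ever smaller equal steps. The resulting bound is
    controlled by a polynomial in the step size, whose value at [0] is the tail with one more
    term. *)
Lemma scenario_bound ks (rho : T -> R) N (a b : R) : measurable_fun setT rho ->
  (forall x, (0 <= rho x)%R) -> \int[P]_x (rho x)%:E = b%:E -> (0 <= a < b)%R ->
  wint P rho N (viol_gt rho ks a) <= (binomial_tail (size ks) N a b)%:E.
Proof.
elim: ks rho N a b => [|k ks IHks] rho N a b mrho rho0 rhob /andP[a0 ab].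
  (* With no index left nothing is violated, and the indicator vanishes since [a >= 0]. *)
  rewrite /binomial_tail big_geq//.
  have wint0 : wint P rho N (fun=> 0) <= 0.
    elim: N => [|N IH]//=; rewrite le_eqVlt; apply/orP; left; apply/eqP.
    apply: integral0_eq => x _; suff -> : wint P rho N (fun=> 0) = 0 by rewrite mule0.
    by apply/eqP; rewrite eq_le IH wint_ge0.
  apply: le_trans wint0; apply: le_wint => // s; first exact: viol_gt_ge0.
  move=> _; rewrite /viol_gt /viol integral0 ifF//.
  by apply/negbTE; rewrite -leNgt lee_fin.
have tailE : binomial_tail (size (k :: ks)) N a b = ((b - a) ^+ N +
    \sum_(0 <= i < size ks) 'C(N, i.+1)%:R * a ^+ i.+1 * (b - a) ^+ (N - i.+1))%R.
  by rewrite /binomial_tail /= big_nat_recl// bin0 expr0 !mul1r subn0.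
have sum0 : (0 <= \sum_(0 <= i < size ks) 'C(N, i.+1)%:R * a ^+ i.+1 * (b - a) ^+ (N - i.+1))%R.
  apply: sumr_ge0 => i _; rewrite !mulr_ge0 ?exprn_ge0// subr_ge0; exact: ltW.
(* A positive step size requires [a > 0]; for [a = 0] the total mass [b ^+ N] is the term of index
   [0]. *)
move: a0; rewrite le_eqVlt => /predU1P[a0|a0].
  apply: (le_trans (le_wint_viol_gt _ _ _ mrho rho0 rhob)).
  rewrite lee_fin tailE -[leLHS]addr0 lerD//.
  by rewrite -a0 subr0.
pose e := (b - a)%R; have e0 : (0 < e)%R by rewrite subr_gt0.
(* In every sweep the mass exceeds the threshold of the remaining indices by [e + h], hence the base
   of the powers. *)
pose phi := ((e ^+ N)%:P + \sum_(0 <= i < size ks)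
   ('C(N, i.+1)%:R * a ^+ i.+1)%:P * (e%:P + 'X) ^+ (N - i.+1))%R.
have phiE h : (phi.[h] = e ^+ N + \sum_(0 <= i < size ks)
    ('C(N, i.+1)%:R * a ^+ i.+1) * (e + h) ^+ (N - i.+1))%R.
  rewrite /phi hornerD hornerC horner_sum; congr (_ + _)%R.
  by apply: eq_bigr => i _; rewrite !hornerE.
have le_phi K : wint P rho N (viol_gt rho (k :: ks) a) <= (phi.[a / K.+1%:R])%:E.
  pose h := (a / K.+1%:R)%R; have h0 : (0 < h)%R by rewrite divr_gt0.
  have aE : (K.+1%:R * h = a)%R by rewrite mulrC divfK// pnatr_eq0.
  have := @sweep_iter ks N e h h0 e0 IHks k K.+1 rho mrho rho0.
  rewrite aE => /(_ _)/le_trans; apply; first by rewrite rhob subrK.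
  rewrite lee_fin phiE -/h lerD2l /binomial_tail.
  rewrite [leLHS](_ : _ = \sum_(0 <= j < size ks) ('C(N, j.+1)%:R * h ^+ j.+1 *
      (e + h) ^+ (N - j.+1)) * \sum_(0 <= i < K.+1) j.+1%:R * i%:R ^+ j)%R; last first.
    under eq_bigr do rewrite big_distrr/=.
    rewrite exchange_big/=; apply: eq_bigr => j _; rewrite big_distrr/=.
    apply: eq_bigr => i _; rewrite addrK exprMn exprS -subn1 -subnDA add1n.
    have : (N%:R * 'C(N.-1, j)%:R = j.+1%:R * 'C(N, j.+1)%:R :> R)%R.
      by rewrite -!natrM mul_bin_diag.
    rewrite -subn1 => NC.
    transitivity ((N%:R * 'C(N - 1, j)%:R) * (h * h ^+ j * i%:R ^+ j * (e + h) ^+ (N - j.+1)))%R.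
      by ring.
    by rewrite NC; ring.
  apply: ler_sum => j _.
  rewrite [leRHS](_ : _ = ('C(N, j.+1)%:R * h ^+ j.+1 * (e + h) ^+ (N - j.+1)) *
     K.+1%:R ^+ j.+1)%R; last by rewrite -{1}aE exprMn; ring.
  rewrite ler_wpM2l ?sum_expr_le// mulr_ge0 ?mulr_ge0 ?exprn_ge0//; first exact: ltW.
  by rewrite addr_ge0// ltW.
have fin : wint P rho N (viol_gt rho (k :: ks) a) \is a fin_num.
  rewrite ge0_fin_numE ?(le_lt_trans (le_phi 0%N)) ?ltry//.
  by apply: wint_ge0 => // s; exact: viol_gt_ge0.
rewrite -(fineK fin) lee_fin.
have -> : binomial_tail (size (k :: ks)) N a b = (phi.[0])%R.
  by rewrite tailE phiE addr0.
have cv : (phi.[a / n.+1%:R] @[n --> \oo] --> phi.[0])%R.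
  apply: continuous_cvg; first exact: continuous_horner.
  rewrite -[X in _ --> X](mulr0 a); apply: cvgMr; exact: cvg_harmonic.
rewrite leNgt; apply/negP => lt.
move/cvgr_lt : cv => /(_ _ lt)[K _ /(_ K (leqnn K))] /=.
by rewrite ltNge -lee_fin fineK// le_phi.
Qed.

End scenario.

(** * Events of exponentially small probability *)

Section rare.
Context {R : realType} {d : measure_display} {T : measurableType d}.
Variable P : probability T R.
Implicit Types g u : seq T -> \bar R.

(** A function stands for the events whose indicator it dominates, so that a union bound is a sum;
    one ratio and one constant serve all sample sizes. *)
Definition rare g := [/\ forall s, 0 <= g s, seq_measurable g &
  exists theta C : R, [/\ (0 < theta < 1)%R, (0 <= C)%R &
   forall N, wint P (fun=> 1%R) N g <= (C * theta ^+ N)%:E]].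

Lemma le_prodP_wint N (A : set (N.-tuple T)) g : (forall s, 0 <= g s) ->
  (forall t, A t -> 1 <= g t) -> prodP P A <= wint P (fun=> 1%R) N g.
Proof.
have prodP_ge0 M (B : set (M.-tuple T)) : 0 <= prodP P B.
  elim: M B => [|M IH] B /=; first by case: ifP.
  by apply: integral_ge0 => x _; exact: IH.
elim: N A g => [|N IH] A g g0 Ag /=.
  by case: ifPn => [/asboolP At|_]; [exact: (Ag [tuple])|exact: g0].
apply: ge0_le_integral_nomeas => x; first exact: prodP_ge0.
by rewrite mul1e; apply: IH => // t At; exact: (Ag _ At).
Qed.

Lemma rare0 : rare (fun=> 0).
Proof.
split => //; exists (1 / 2)%R, 0%R; split => //; first by lra.
move=> N; rewrite mul0r; elim: N => [|N IH] //=.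
rewrite integral0_eq// => x _; suff -> : wint P (fun=> 1%R) N (fun=> 0) = 0 by rewrite mule0.
by apply/eqP; rewrite eq_le IH wint_ge0.
Qed.

Lemma rareD g u : rare g -> rare u -> rare (fun s => g s + u s).
Proof.
move=> [g0 mg [th1 [C1 [/andP[th10 th11] C10 gC1]]]].
move=> [u0 mu [th2 [C2 [/andP[th20 th21] C20 uC2]]]].
split; first by move=> s; apply: adde_ge0; [exact: g0|exact: u0].
  by move=> N; exact: (emeasurable_funD (mg N) (mu N)).
exists (Num.max th1 th2), (C1 + C2)%R; split; last 1 first.
- move=> N; rewrite wintD// (le_trans (leeD (gC1 N) (uC2 N)))// -EFinD lee_fin mulrDl.
  by rewrite lerD// ler_wpM2l// lerXn2r ?nnegrE ?le_max ?lexx ?orbT ?(ltW th10) ?(ltW th20).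
- by rewrite lt_max th10 gt_max th11.
- exact: addr_ge0.
Qed.

Lemma rare_sum (I : Type) (r : seq I) (g : I -> seq T -> \bar R) :
  (forall i, rare (g i)) -> rare (fun s => \sum_(i <- r) g i s).
Proof.
move=> rg; elim: r => [|i r IH].
  by under eq_fun do rewrite big_nil; exact: rare0.
by under eq_fun do rewrite big_cons; exact: rareD.
Qed.

(** By independence the integral of the product is the [N]-th power of a number below [1]. *)
Lemma rare_prod (w : T -> R) : (forall x, (0 <= w x)%R) -> measurable_fun setT w ->
  \int[P]_x (w x)%:E < 1 -> rare (fun s => (\prod_(x <- s) w x)%:E).
Proof.
move=> w0 mw wlt1; split.
- by move=> s; rewrite lee_fin prodr_ge0.
- move=> N; apply/measurable_EFinP.
  under eq_fun do rewrite big_tuple.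
  apply: (@measurable_prod _ _ _ _ _ _ (fun i (t : N.-tuple T) => w (tnth t i))) => i _.
  exact: (measurableT_comp mw (measurable_tnth i)).
have I0 : 0 <= \int[P]_x (w x)%:E by apply: integral_ge0 => x _; rewrite lee_fin.
have If : \int[P]_x (w x)%:E \is a fin_num by rewrite ge0_fin_numE// (lt_trans wlt1)// ltry.
set b := fine (\int[P]_x (w x)%:E).
have bE : \int[P]_x (w x)%:E = b%:E by rewrite fineK.
(* The maximum with [1 / 2] keeps the ratio positive when the integral is [0]. *)
exists (Num.max b (1 / 2))%R, 1%R; split => //.
- have b1 : (b < 1)%R by rewrite -lte_fin -bE.
  by rewrite lt_max gt_max b1; lra.
move=> N; rewrite wint_prod// (wint_cst1 N mw w0 bE) lee_fin mul1r.
rewrite lerXn2r ?nnegrE// ?le_max ?lexx// -lee_fin -bE I0//.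
Qed.

Lemma rare_null (B : T -> bool) : measurable_fun setT B -> P [set x | B x] = 0 ->
  rare (fun s => if has B s then 1 else 0).
Proof.
move=> mB PB; split; first by move=> s; case: ifP.
  move=> N; apply: measurable_fun_ifT => //.
  rewrite (_ : (fun _ => _) = (fun t : N.-tuple T => has (fun i => B (tnth t i)) (enum 'I_N))).
    apply: (@measurable_has_fun _ _ _ (fun i (t : N.-tuple T) => B (tnth t i))) => i.
    exact: (measurableT_comp mB (measurable_tnth i)).
  by apply/funext => t; rewrite -[in LHS](map_tnth_enum t) has_map.
exists (1 / 2)%R, 0%R; split => //; first by lra.
have iB : \int[P]_x (if B x then 1 else 0) = 0.
  by rewrite -[RHS]PB -integral_pred//; apply: eq_integral => x _; case: (B x).
have mBe : measurable_fun setT (fun x => if B x then 1 else 0 : \bar R).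
  exact: measurable_fun_ifT.
move=> N; rewrite mul0r; elim: N => [|N IH] //=.
(* Union bound: the head falls in [B], or a later point does. *)
apply: (@le_trans _ _ (\int[P]_x ((if B x then 1 else 0) +
    wint P (fun=> 1%R) N (fun s => if has B s then 1 else 0)))).
  apply: ge0_le_integral_nomeas => x.
    by rewrite mule_ge0// wint_ge0// => s; case: ifP.
  rewrite mul1e; case: ifPn => Bx /=; last by rewrite add0e.
  apply: (@le_trans _ _ (wint P (fun=> 1%R) N (fun=> 1))).
    by apply: le_wint.
  rewrite (@wint_cst1 _ _ _ _ _ _ 1%R)// ?expr1n ?leeDl//.
    by apply: wint_ge0 => // s; case: ifP.
  by rewrite (integral_cst P measurableT 1) mul1e; exact: probability_setT.
rewrite ge0_integralD//=.
- rewrite iB add0e (integral_cst P measurableT).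
  by rewrite (_ : _ [set: T] = 1) ?mule1//; exact: probability_setT.
- by move=> x _; case: ifP.
- by move=> x _; apply: wint_ge0 => // s; case: ifP.
Qed.

End rare.

(** * An exponential moment below one for a variable of negative mean *)

Section chernoff.
Context {R : realType} {d : measure_display} {T : measurableType d}.
Variable P : probability T R.

(** The upper bound is [1 - y <= exp(-y)] multiplied by [exp(y)]. *)
Lemma expR_sub1_bounds (y : R) : (y <= expR y - 1 <= y * expR y)%R.
Proof.
apply/andP; split; first by rewrite lerBrDl expR_ge1Dx.
have := expR_ge1Dx (- y)%R; rewrite -(ler_pM2r (expR_gt0 y)) -expRD addNr expR0.
by rewrite mulrDl mul1r mulNr; lra.
Qed.

(* [(expR (t * Y) - 1) / t] converges to [Y] as [t] decreases to [0], dominatedly. *)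
Lemma exp_moment_lt1 (Y : T -> R) (t0 : R) : measurable_fun setT Y ->
  P.-integrable setT (EFin \o Y) -> \int[P]_x (Y x)%:E < 0 ->
  (0 < t0)%R -> \int[P]_x (expR (t0 * Y x))%:E < +oo ->
  exists2 t : R, (0 < t)%R & \int[P]_x (expR (t * Y x))%:E < 1.
Proof.
move=> mY iY Yneg t00 iexp.
(* Starting from [t0 / 2] leaves another factor [exp(t0 * Y / 2)] to absorb the linear factor [Y] in
   the domination by [B] where [Y] is positive. *)
pose t (n : nat) : R := (t0 / n.+2%:R)%R.
have tp n : (0 < t n)%R by rewrite divr_gt0.
pose phi n x : R := ((expR (t n * Y x) - 1) / t n)%R.
pose B x : R := (`|Y x| + 2 / t0 * expR (t0 * Y x))%R.
have mexp (r : R) : measurable_fun setT (fun x => expR (r * Y x)).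
  by apply: measurableT_comp => //; apply: measurable_funM => //; exact: measurable_cst.
have mphi n : measurable_fun setT (phi n).
  apply: measurable_funM => //; exact: measurable_funB.
have phil n x : (Y x <= phi n x)%R.
  by rewrite ler_pdivlMr// mulrC; case/andP: (expR_sub1_bounds (t n * Y x)).
have phiu n x : (phi n x <= Y x * expR (t n * Y x))%R.
  rewrite ler_pdivrMr// (_ : Y x * _ * _ = (t n * Y x) * expR (t n * Y x))%R; last by ring.
  by case/andP: (expR_sub1_bounds (t n * Y x)).
have phiB n x : (`|phi n x| <= B x)%R.
  have e0 : (0 <= 2 / t0 * expR (t0 * Y x))%R.
    by rewrite mulr_ge0 ?expR_ge0// divr_ge0// ltW.
  have [Y0|Y0] := leP (Y x) 0%R.
    rewrite ler0_norm; last first.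
      by rewrite (le_trans (phiu n x))// mulr_le0_ge0// expR_ge0.
    by rewrite /B ler0_norm//; have := phil n x; lra.
  rewrite ger0_norm; last exact: le_trans (ltW Y0) (phil n x).
  rewrite (le_trans (phiu n x))// /B (@le_trans _ _ (2 / t0 * expR (t0 * Y x))%R) ?lerDr//.
  have -> : (t0 * Y x = t0 * Y x / 2 + t0 * Y x / 2)%R by lra.
  rewrite expRD mulrA; apply: ler_pM; [exact: ltW|exact: expR_ge0| |].
    rewrite [leLHS](_ : _ = 2 / t0 * (t0 * Y x / 2))%R; last by field; rewrite gt_eqF.
    rewrite ler_wpM2l ?divr_ge0 ?(ltW t00)//.
    by have := expR_ge1Dx (t0 * Y x / 2); lra.
  rewrite ler_expR /t mulrAC ler_pM2l ?mulr_gt0// lef_pV2 ?posrE//.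
  by rewrite (ler_nat _ 2).
have iB : P.-integrable setT (EFin \o B).
  apply: (@integrableD _ _ _ _ _ measurableT (fun x => `|Y x|%:E)
     (fun x => (2 / t0 * expR (t0 * Y x))%:E)).
    exact: integrable_norm.
  apply: (@integrableZl _ _ _ _ _ measurableT (2 / t0) (fun x => (expR (t0 * Y x))%:E)).
  apply/integrableP; split; first exact/measurable_EFinP.
  by under eq_integral do rewrite /= ger0_norm ?expR_ge0//.
have [||||| _ _ cv] := @dominated_convergence _ _ _ P _ measurableT
  (fun n x => (phi n x)%:E) (fun x => (Y x)%:E) (fun x => (B x)%:E).
- by move=> n; exact/measurable_EFinP.
- exact/measurable_EFinP.
- apply: aeW => x _; apply/cvg_EFin; first by near=> n.
  have ct : t n @[n --> \oo] --> (0 : R)%R.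
    rewrite -[X in _ --> X](mulr0 t0); apply: cvgMr.
    by have := @cvg_harmonic R; rewrite -cvg_shiftS.
  have cexp : (Y x * expR (t n * Y x))%R @[n --> \oo] --> (Y x)%R.
    rewrite -[X in _ --> X]mulr1; apply: cvgMr.
    rewrite -[X in _ --> X]expR0; apply: continuous_cvg; first exact: continuous_expR.
    by rewrite -[X in _ --> X](mul0r (Y x)); apply: cvgMl.
  apply: (squeeze_cvgr _ (cvg_cst (Y x)) cexp).
  by near=> n; rewrite /= phil phiu.
- exact: iB.
- by apply: aeW => x n _; rewrite /= lee_fin.
have /cvgr_lt : fine (\int[P]_x (phi n x)%:E) @[n --> \oo] --> fine (\int[P]_x (Y x)%:E).
  by apply: fine_cvg; rewrite fineK//; exact: integrable_fin_num.
have iphi n : P.-integrable setT (fun x => (phi n x)%:E).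
  apply: (@le_integrable _ _ _ _ _ measurableT _ (EFin \o B)) => //.
    exact/measurable_EFinP.
  by move=> x _; rewrite /= lee_fin (le_trans (phiB n x))// ler_norm.
have Yfin : \int[P]_x (Y x)%:E \is a fin_num by exact: integrable_fin_num.
move=> /(_ 0%R); case.
  by move: Yneg; rewrite -{1}(fineK Yfin) lte_fin.
move=> N _ /(_ N (leqnn N)) /= Nneg; exists (t N) => //.
rewrite (_ : \int[P]_x _ = \int[P]_x (1 + (t N)%:E * (phi N x)%:E)); last first.
  apply: eq_integral => x _; rewrite -EFinM -EFinD; congr EFin.
  by rewrite /phi; field; rewrite gt_eqF.
rewrite (integralD measurableT)//=; first last.
- exact: integrableZl.
- exact: finite_measure_integrable_cst.
rewrite (integral_cst P measurableT 1) mul1e (integralZl measurableT)//.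
rewrite (_ : _ [set: T] = 1); last exact: probability_setT.
rewrite -[X in _ * X]fineK ?integrable_fin_num// -EFinM -EFinD lte_fin.
by rewrite gtrDl nmulr_llt0.
Unshelve. all: by end_near. Qed.

End chernoff.

(** * Continuity of finite convex functions *)

Section convexity.
Context {R : realType} {n : nat}.
Implicit Types (x y d : 'rV[R]_n) (c : 'rV[R]_n -> R).

Lemma norm_coord_le (x : 'rV[R]_n) (i : 'I_n) : (`|x ord0 i| <= `|x|)%R.
Proof.
have /mapP[j Hj ->] : `|x ord0 i|%R \in [seq `|x v.1 v.2|%R | v : 'I_1 * 'I_n].
  by apply/mapP; exists (ord0, i) => //=; rewrite mem_enum.
by rewrite [leRHS]/Num.norm /= mx_normrE; apply/bigmax_geP; right => /=; exists j.
Qed.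

Lemma convex_setP (X : set 'rV[R]_n) : convex_set X ->
  forall x y t, X x -> X y -> (0 <= t <= 1)%R -> X ((1 - t) *: x + t *: y)%R.
Proof.
move=> cX x y t Xx Xy /andP[t0 t1].
by have := cX y x (Itv01 t0 t1); rewrite !inE => /(_ Xy Xx); rewrite /conv/= addrC.
Qed.

Lemma convex_functionP c : convex_function setT c ->
  forall x y t, (0 <= t <= 1)%R ->
  (c ((1 - t) *: x + t *: y) <= (1 - t) * c x + t * c y)%R.
Proof.
move=> cc x y t /andP[t0 t1].
have := cc (Itv01 t0 t1) y x; rewrite !inE => /(_ Logic.I Logic.I).
by rewrite convRE /conv /= (addrC (t *: y)%R) (addrC (t * c y)%R).
Qed.

(** Coordinates are added one at a time: the new point is the midpoint of a move by [2 v_i] along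
    axis [i] and of the earlier sum taken for [2 v], and each of these has a linear bound. *)
Lemma convex_coord_bound c (x : 'rV[R]_n) (s : seq 'I_n) : convex_function setT c ->
  exists A r : R, [/\ (0 <= A)%R, (0 < r)%R & forall v : 'rV[R]_n, (`|v| <= r)%R ->
    (c (x + \sum_(i <- s) v ord0 i *: delta_mx ord0 i) <= c x + A * `|v|)%R].
Proof.
move=> /convex_functionP cc; elim: s => [|i s [A [r [A0 r0 IH]]]].
  by exists 0%R, 1%R; split => // v _; rewrite big_nil mul0r !addr0.
pose e : 'rV[R]_n := delta_mx ord0 i.
pose B := (`|c (x + e) - c x| + `|c (x - e) - c x|)%R.
have lineB t : (`|t| <= 1)%R -> (c (x + t *: e) <= c x + `|t| * B)%R.
  move=> t1; have [t0|/ltW t0] := leP 0%R t.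
    rewrite (ger0_norm t0); rewrite (ger0_norm t0) in t1.
    have tt : (0 <= t <= 1)%R by rewrite t0.
    have := cc x (x + e)%R t tt.
    rewrite scalerDr addrA -scalerDl subrK scale1r => /le_trans; apply.
    have -> : ((1 - t) * c x + t * c (x + e) = c x + t * (c (x + e) - c x))%R by ring.
    by rewrite lerD2l ler_wpM2l// /B (le_trans (ler_norm _))// lerDl.
  rewrite (ler0_norm t0); rewrite (ler0_norm t0) in t1.
  have tt : (0 <= - t <= 1)%R by rewrite oppr_ge0 t0.
  have := cc x (x - e)%R (- t)%R tt.
  have -> : ((1 - - t) *: x + (- t) *: (x - e) = x + t *: e)%R.
    by rewrite opprK scalerDl scale1r scalerBr !scaleNr opprK addrA addrK.
  move=> /le_trans; apply.
  have -> : ((1 - - t) * c x + - t * c (x - e) = c x + - t * (c (x - e) - c x))%R by ring.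
  by rewrite lerD2l ler_wpM2l ?oppr_ge0// /B (le_trans (ler_norm _))// lerDr.
have B0 : (0 <= B)%R by rewrite addr_ge0.
(* The radius is halved because both bounds are applied to [2 *: v]; the [1] keeps the axis move
   within unit length. *)
exists (A + B)%R, (Num.min r 1 / 2)%R; split.
- exact: addr_ge0.
- by rewrite divr_gt0// lt_min r0 ltr01.
move=> v; rewrite ler_pdivlMr// le_min => /andP[vr v1].
have v2 : (`|2 *: v| = `|v| * 2)%R by rewrite normrZ ger0_norm// mulrC.
have half01 : (0 <= (1 / 2 : R) <= 1)%R by lra.
have := cc (x + (2 * v ord0 i) *: e)%R
  (x + \sum_(j <- s) (2 *: v)%R ord0 j *: delta_mx ord0 j)%R (1 / 2)%R half01.
have -> : ((1 - 1 / 2) *: (x + (2 * v ord0 i) *: e) + (1 / 2) *: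
   (x + \sum_(j <- s) (2 *: v)%R ord0 j *: delta_mx ord0 j) =
   x + \sum_(j <- i :: s) v ord0 j *: delta_mx ord0 j)%R.
  rewrite big_cons !scalerDr addrACA -scalerDl subrK scale1r; congr (_ + (_ + _))%R.
    by rewrite scalerA; congr (_ *: _)%R; lra.
  rewrite scaler_sumr; apply: eq_bigr => j _; rewrite !mxE scalerA.
  by congr (_ *: _)%R; lra.
move=> /le_trans; apply.
have h1 := IH (2 *: v)%R; rewrite v2 in h1; have {}h1 := h1 vr.
have vi : (`|2 * v ord0 i| <= `|v| * 2)%R.
  by rewrite normrM ger0_norm// mulrC ler_wpM2r// norm_coord_le.
have h2 := lineB (2 * v ord0 i)%R (le_trans vi v1).
have h3 : (`|2 * v ord0 i| * B <= `|v| * 2 * B)%R by rewrite ler_wpM2r.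
by lra.
Qed.

Lemma convex_function_continuous c : convex_function setT c -> continuous c.
Proof.
move=> cc x.
have [A [r [A0 r0 bd]]] := convex_coord_bound x (enum 'I_n) cc.
have {}bd v : (`|v| <= r)%R -> (c (x + v) <= c x + A * `|v|)%R.
  move=> /bd; rewrite big_enum/= => /(le_trans _); apply.
  by rewrite {1}(row_sum_delta v).
move=> U /= /nbhs_ballP[eps /= eps0 epsU].
have A1 : (0 < A + 1)%R by rewrite ltr_wpDl.
have del0 : (0 < Num.min r (eps / (A + 1)))%R by rewrite lt_min r0 divr_gt0.
apply/nbhs_ballP; exists (Num.min r (eps / (A + 1)))%R => //= y.
rewrite -ball_normE /= distrC => yx; apply: epsU; move: yx; rewrite -ball_normE /=.
rewrite lt_min ltr_pdivlMr// => /andP[yr ye].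
have h1 := bd (y - x)%R (ltW yr); rewrite addrC subrK in h1.
have h2 := bd (x - y)%R; rewrite distrC in h2; have {}h2 := h2 (ltW yr).
have half01 : (0 <= (1 / 2 : R) <= 1)%R by lra.
(* [x] is the midpoint of [y] and its reflection, so the upper bound at the reflection yields a
   lower bound at [y]. *)
have := convex_functionP cc y (x + (x - y))%R half01.
have -> : ((1 - 1 / 2) *: y + (1 / 2) *: (x + (x - y)) = x)%R.
  have -> : (1 - 1 / 2 = 1 / 2 :> R)%R by lra.
  rewrite -scalerDr addrCA subrKC scalerDr -scalerDl.
  by rewrite (_ : 1 / 2 + 1 / 2 = 1 :> R)%R ?scale1r//; lra.
move=> h3.
have h4 : (A * `|y - x| < eps)%R.
  by apply: le_lt_trans ye; rewrite mulrC ler_wpM2l// lerDl.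
by rewrite ltr_norml; apply/andP; split; lra.
Qed.

End convexity.

Lemma near_forall_fin {T : Type} (F : set_system T) {FF : Filter F} (I : finType)
    (Q : I -> T -> Prop) :
  (forall i, \forall x \near F, Q i x) -> \forall x \near F, forall i, Q i x.
Proof.
move=> FQ; suff H (s : seq I) : \forall x \near F, forall i, i \in s -> Q i x.
  by apply: filterS (H (enum I)) => x Qx i; apply: Qx; rewrite mem_enum.
elim: s => [|i s IH]; first by apply: nearW.
apply: filterS2 (FQ i) IH => x Qi Qs j; rewrite inE => /predU1P[->//|].
exact: Qs.
Qed.

(** * Null sets and the essential infimum *)

Section ae_facts.
Context {R : realType} {d : measure_display} {T : measurableType d}.
Variable P : probability T R.

Lemma aeP0 (B : T -> bool) : measurable_fun setT B ->
  {ae P, forall x, ~~ B x} <-> P [set x | B x] = 0.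
Proof.
move=> mB; have mS : measurable [set x | B x].
  by rewrite -[X in measurable X]setTI; exact: mB.
split=> [aeB|PB]; last first.
  by exists [set x | B x]; split => // x /= /negP; rewrite negbK.
apply: (@measure_negligible _ _ _ P) => //.
apply: negligibleS aeB => x /= Bx; rewrite /setC/=; exact/negP/negPn.
Qed.

(** If all the sets [h < c - 1/(k+1)] were null, so would be their union [h < c]. *)
Lemma ae_lt_inf (h : T -> R) (c : R) : measurable_fun setT h ->
  0 < P [set x | (h x < c)%R] ->
  exists2 c', (c' < c)%R & 0 < P [set x | (h x < c')%R].
Proof.
move=> mh; apply: contraPP => /forall2NP H.
have mlt c' : measurable_fun setT (fun x => h x < c')%R.
  by apply: measurable_fun_ltr => //; exact: measurable_cst.
have H0 k : {ae P, forall x, ~~ (h x < c - k.+1%:R^-1)%R}.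
  apply/(aeP0 (mlt _)); have [/negP|/negP] := H (c - k.+1%:R^-1)%R.
    by rewrite ltrBlDr ltrDl invr_gt0 ltr0n.
  by rewrite lt0e measure_ge0 andbT negbK => /eqP.
apply/negP; rewrite lt0e negb_and negbK; apply/orP; left; apply/eqP.
apply/(aeP0 (mlt _)); apply: filterS (ae_foralln H0) => x hx.
apply/negP => xc; have e0 : (0 < c - h x)%R by rewrite subr_gt0.
have [k _ /(_ k (leqnn k)) /=] := near_natSinv_lt e0.
by move=> h1; have := hx k; rewrite -leNgt lerBlDr -lerBlDl leNgt h1.
Qed.

Lemma ae_quantile0 (h : T -> R) (c : R) : measurable_fun setT h ->
  c%:E < quantile P h 0 -> {ae P, forall x, (c < h x)%R}.
Proof.
move=> mh cq.
have mle : measurable_fun setT (fun x => h x <= c)%R.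
  by apply: measurable_fun_ler => //; exact: measurable_cst.
suff H : {ae P, forall x, ~~ (h x <= c)%R}.
  by apply: filterS H => x; rewrite -ltNge.
apply/(aeP0 mle)/eqP; rewrite -[_ == _]negbK; apply/negP => P0.
move: cq; rewrite ltNge => /negP; apply; apply: ereal_inf_lbound.
by exists c => //=; rewrite lt0e P0 measure_ge0.
Qed.

Lemma quantile0_ge (h : T -> R) (c : R) : {ae P, forall x, (c <= h x)%R} ->
  measurable_fun setT h -> c%:E <= quantile P h 0.
Proof.
move=> cae mh; apply: le_ereal_inf_tmp => _ [t /= Pt <-]; rewrite lee_fin leNgt; apply/negP => tc.
have mle : measurable_fun setT (fun x => h x <= t)%R.
  by apply: measurable_fun_ler => //; exact: measurable_cst.
move: Pt; rewrite (_ : P _ = 0) ?ltxx//; apply/(aeP0 mle).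
by apply: filterS cae => x /(lt_le_trans tc); rewrite -ltNge.
Qed.

End ae_facts.

(** * The sample average problem: finiteness, segments and local exclusion *)

Section saa.
Context {R : realType} {d : measure_display} {T : measurableType d}.
Variable P : probability T R.
Context {n : nat} (f : T -> 'rV[R]_n -> \bar R).
Hypothesis Hfm : forall xi x, f xi x != -oo.
Hypothesis Hfmeas : forall x, measurable_fun setT (fun xi => f xi x).
Hypothesis HFlow : forall x, -oo < expF P f x.
Variable kappa : T -> R.
Hypothesis Hk0 : forall xi, (0 <= kappa xi)%R.
Hypothesis Hkmeas : measurable_fun setT kappa.
Hypothesis HkL : P.-integrable setT (EFin \o kappa).
Hypothesis Hlip : forall xi x y, f xi x < +oo -> f xi y < +oo ->
  (`|fine (f xi x) - fine (f xi y)| <= kappa xi * `|x - y|)%R.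

(** [fine] sends [+oo] to [0], so [g] represents [f] only where [f] is finite. *)
Let g x xi : R := fine (f xi x).

Let finE xi x : f xi x < +oo -> f xi x = (g x xi)%:E.
Proof. by rewrite /g; move: (Hfm xi x); case: (f xi x). Qed.

Let mg x : measurable_fun setT (g x).
Proof. exact: measurableT_comp. Qed.

Let mfin x : measurable_fun setT (fun xi => f xi x < +oo).
Proof. by apply: measurable_fun_lte => //; exact: measurable_cst. Qed.

Lemma expF_integrable x : expF P f x < +oo -> P.-integrable setT (f^~ x).
Proof.
move=> Flty; have := HFlow x; move: Flty; rewrite /expF integralE => Flt Fgt.
have : 0 <= \int[P]_x0 (fun xi => f xi x)^\+ x0 by apply: integral_ge0.
have : 0 <= \int[P]_x0 (fun xi => f xi x)^\- x0 by apply: integral_ge0.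
move=> n0 p0; apply/integrableP; split => //.
under eq_integral do rewrite -/((abse \o (f^~ x)) _) fune_abse.
rewrite ge0_integralD//; first last.
- exact: measurable_funeneg.
- exact: measurable_funepos.
move: n0 p0 Flt Fgt; set A := integral _ _ _; set B := integral _ _ _.
by case: A => [a| |]; case: B => [b| |] //=; rewrite ?ltry.
Qed.

Lemma expF_ae_fin x : expF P f x < +oo -> {ae P, forall xi, f xi x < +oo}.
Proof.
move=> /expF_integrable /(integrable_ae measurableT); apply: filterS => xi /(_ Logic.I).
by rewrite fin_numE ltey => /andP[].
Qed.

Lemma fine_integrable x : expF P f x < +oo -> P.-integrable setT (EFin \o g x).
Proof.
move=> /expF_integrable; apply: le_integrable => //.
- exact/measurable_EFinP.
- by move=> xi _; rewrite /g /=; case: (f xi x) => [r| |] //=; exact: leey.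
Qed.

Lemma expF_fine x : expF P f x < +oo -> expF P f x = \int[P]_xi (g x xi)%:E.
Proof.
move=> Fx; apply: ae_eq_integral => //; first exact/measurable_EFinP.
by apply: filterS (expF_ae_fin Fx) => xi fx _; exact: finE.
Qed.

Let lipg xi x y : f xi x < +oo -> f xi y < +oo -> (g x xi - g y xi <= kappa xi * `|x - y|)%R.
Proof. by move=> fx fy; rewrite (le_trans (ler_norm _))// Hlip. Qed.

(** The Lipschitz condition dominates [f] at [x] by its integrable value at [x0] plus a multiple of
    [kappa]. *)
Lemma expF_lty x0 x : expF P f x0 < +oo -> {ae P, forall xi, f xi x < +oo} ->
  expF P f x < +oo.
Proof.
move=> F0 fx; apply: integrable_lty => //; apply/integrableP; split => //.
pose h xi := (`|g x0 xi| + `|x - x0| * kappa xi)%R.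
have ih : P.-integrable setT (EFin \o h).
  apply: (@integrableD _ _ _ _ _ measurableT (fun xi => `|g x0 xi|%:E)
     (fun xi => (`|x - x0|%R * kappa xi)%:E)).
    exact/integrable_norm/fine_integrable.
  exact: (@integrableZl _ _ _ _ _ measurableT (`|x - x0|%R) (EFin \o kappa)).
apply: le_lt_trans (integrable_lty measurableT ih).
apply: ae_ge0_le_integral => //.
- exact: measurableT_comp.
- by move=> xi _; rewrite lee_fin addr_ge0// mulr_ge0.
- exact: measurable_int ih.
apply: filterS2 fx (expF_ae_fin F0) => xi fx f0 _.
rewrite finE//= lee_fin /h mulrC.
rewrite -lerBlDl (le_trans (lerB_dist _ _))//; exact: Hlip.
Qed.

Lemma sum_finE y (s : seq T) : \sum_(xi <- s) f xi y =
  if all (fun xi => f xi y < +oo) s then (\sum_(xi <- s) g y xi)%:E else +oo.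
Proof.
elim: s => [|xi s IH]; first by rewrite !big_nil.
rewrite !big_cons /= IH; have [fy|] := boolP (f xi y < +oo).
  by rewrite (finE fy); case: ifP => //= _; rewrite EFinD.
by rewrite ltey negbK => /eqP -> /=; case: ifP.
Qed.

Lemma hatF_le N (s : N.-tuple T) x y : all (fun xi => f xi x < +oo) s ->
  hatF f s y <= hatF f s x ->
  all (fun xi => f xi y < +oo) s /\
  (\sum_(xi <- s) g y xi <= \sum_(xi <- s) g x xi)%R.
Proof.
(* For the empty sample both claims are trivial; otherwise the factor [1 / N] cancels. *)
move=> fx; case: N s fx => [|N] s fx.
  by rewrite tuple0 /= !big_nil.
rewrite /hatF -!(big_tuple _ _ s predT (fun xi => f xi _)) lee_pmul2l ?lte_fin//.
by rewrite !sum_finE fx; case: ifP => //; rewrite lee_fin.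
Qed.

Lemma le_sum_all (a b : T -> R) (p : pred T) s : (forall x, p x -> (a x <= b x)%R) ->
  all p s -> (\sum_(x <- s) a x <= \sum_(x <- s) b x)%R.
Proof.
move=> ab; elim: s => [|x s IH] /=; first by rewrite !big_nil.
by move=> /andP[px /IH ps]; rewrite !big_cons lerD// ab.
Qed.

Lemma segment_improves x y (t : R) s : (forall xi, ext_convex (f xi)) -> (0 <= t <= 1)%R ->
  all (fun xi => f xi x < +oo) s -> all (fun xi => f xi y < +oo) s ->
  (\sum_(xi <- s) g y xi <= \sum_(xi <- s) g x xi)%R ->
  let z := ((1 - t) *: x + t *: y)%R in
  all (fun xi => f xi z < +oo) s /\
  (\sum_(xi <- s) g z xi <= \sum_(xi <- s) g x xi)%R.
Proof.
move=> fcv t01 fx fy yx z.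
pose p xi := (f xi x < +oo) && (f xi y < +oo).
have ps : all p s by rewrite all_predI fx fy.
have fz xi : p xi -> f xi z <= ((1 - t) * g x xi + t * g y xi)%:E.
  by move=> /andP[]; exact: fcv.
have fzlty xi : p xi -> f xi z < +oo by move=> /fz /le_lt_trans; apply; rewrite ltry.
split; first exact: sub_all ps.
have /le_trans : (\sum_(xi <- s) g z xi <= \sum_(xi <- s) ((1 - t) * g x xi + t * g y xi))%R.
  apply: (le_sum_all _ ps) => xi pxi.
  by rewrite -lee_fin -finE ?fz ?fzlty.
apply; rewrite big_split/= -!big_distrr/=.
move: t01 => /andP[t0 t1].
by have := ler_wpM2l t0 yx; lra.
Qed.

Context {I : finType} (c : I -> 'rV[R]_n -> R) (l : I -> T -> R).
Hypothesis Hcc : forall k, continuous (c k).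
Hypothesis Hl : forall k, measurable_fun setT (l k).
Hypothesis Hdom : forall xi x, f xi x < +oo <-> (forall k, (c k x <= l k xi)%R).
Hypothesis Hexp : exists2 t : R, (0 < t)%R & \int[P]_xi (expR (t * kappa xi))%:E < +oo.

(** The local step of a covering argument: one rare function serves a whole neighbourhood of [z]. It
    comes from a constraint that fails at [z] with positive probability or, if there is none, from a
    Chernoff bound in which the term in [kappa] pays for moving from [z] to [z']. *)
Lemma local_exclusion x0 z : expF P f x0 < +oo -> expF P f x0 < expF P f z ->
  exists (O : set 'rV[R]_n) (h : seq T -> \bar R),
  [/\ open O, O z, rare P h & forall z' s, O z' ->
    all (fun xi => f xi x0 < +oo) s -> all (fun xi => f xi z' < +oo) s ->
    (\sum_(xi <- s) g z' xi <= \sum_(xi <- s) g x0 xi)%R -> 1 <= h s].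
Proof.
move=> F0 F0z.
have mlt k (r : R) : measurable_fun setT (fun xi => l k xi < r)%R.
  by apply: measurable_fun_ltr => //; exact: measurable_cst.
have mle k (r : R) : measurable_fun setT (fun xi => r <= l k xi)%R.
  by apply: measurable_fun_ler => //; exact: measurable_cst.
have [[k Pk]|nPk] := pselect (exists k, 0 < P [set xi | (l k xi < c k z)%R]).
  (* Lowering [c k z] to [r] keeps the probability positive and leaves room for an open set of
     points [z'] with [r < c k z']. *)
  have [r rc Pr] := ae_lt_inf (Hl k) Pk.
  exists [set y | (r < c k y)%R],
    (fun s => (\prod_(xi <- s) if (r <= l k xi)%R then 1 else 0)%:E)%R.
  split => //.
  - by apply: (open_comp _ (@open_gt _ r)) => y _; exact: Hcc.
  - apply: rare_prod => //; first by move=> xi; case: ifP.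
      by apply: measurable_fun_ifT => //; exact: measurable_cst.
    rewrite integral_pred//.
    have -> : [set xi | (r <= l k xi)%R] = ~` [set xi | (l k xi < r)%R].
      by apply/seteqP; split => xi /=; rewrite leNgt => /negP.
    rewrite probability_setC; last exact: measurable_predT.
    by rewrite lteBlDr ?fin_num_measure//; [rewrite lteDl|exact: measurable_predT].
  - move=> z' s /= rz' _ fz' _; rewrite lee_fin (_ : \prod_(xi <- s) _ = 1)%R//.
    elim: s fz' => [|xi s IH] /=; first by rewrite big_nil.
    move=> /andP[h /IH E]; rewrite big_cons E mulr1 ifT// (le_trans (ltW rz'))//.
    exact: (Hdom xi z').1.
have fz : {ae P, forall xi, f xi z < +oo}.
  have H : {ae P, forall xi, forall k, ~~ (l k xi < c k z)%R}.
    apply: near_forall_fin => k; apply/aeP0; first exact: mlt.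
    apply/eqP; rewrite -[_ == _]negbK; apply/negP => P0; apply: nPk; exists k.
    by rewrite lt0e P0 measure_ge0.
  by apply: filterS H => xi h; apply/Hdom => k; rewrite leNgt.
have Fz := expF_lty F0 fz.
pose L := fine (\int[P]_xi (kappa xi)%:E).
have LE : \int[P]_xi (kappa xi)%:E = L%:E.
  by rewrite /L fineK//; exact: (integrable_fin_num measurableT HkL).
have L0 : (0 <= L)%R by apply: fine_ge0; apply: integral_ge0 => xi _; rewrite lee_fin.
pose a := fine (expF P f x0); pose b := fine (expF P f z).
have aE : expF P f x0 = a%:E by rewrite /a fineK// fin_numE gt_eqF ?lt_eqF.
have bE : expF P f z = b%:E by rewrite /b fineK// fin_numE gt_eqF ?lt_eqF.
have ab : (a < b)%R by rewrite -lte_fin -aE -bE.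
(* With this [dl] the mean of [Y] below is [a - b + dl * L = - dl]. *)
pose dl := ((b - a) / (L + 1))%R.
have L1 : (0 < L + 1)%R by rewrite ltr_wpDl.
have dl0 : (0 < dl)%R by rewrite divr_gt0// subr_gt0.
have dlE : (dl * (L + 1) = b - a)%R by rewrite divfK// gt_eqF.
pose Y xi := (g x0 xi - g z xi + dl * kappa xi)%R.
have mY : measurable_fun setT Y.
  apply: measurable_funD; first exact: measurable_funB.
  by apply: measurable_funM => //; exact: measurable_cst.
have i1 : P.-integrable setT (fun xi => (g x0 xi)%:E - (g z xi)%:E).
  by apply: integrableB => //; exact: fine_integrable.
have i2 : P.-integrable setT (fun xi => dl%:E * (kappa xi)%:E).
  exact: (@integrableZl _ _ _ _ _ measurableT dl (EFin \o kappa)).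
have iY : P.-integrable setT (EFin \o Y) by exact: integrableD i1 i2.
have EY : \int[P]_xi (Y xi)%:E < 0.
  rewrite (_ : \int[P]_xi _ = \int[P]_xi ((g x0 xi)%:E - (g z xi)%:E + dl%:E * (kappa xi)%:E))//.
  rewrite (integralD measurableT i1 i2) (integralB measurableT); [|exact: fine_integrable..].
  rewrite (integralZl measurableT HkL) LE -!expF_fine// aE bE -EFinM -EFinB -EFinD lte_fin.
  by move: dlE; rewrite mulrDr mulr1; lra.
have [t1 t10 It1] := Hexp.
(* Almost surely [Y <= M * kappa], so the exponential moment of [kappa] at [t1] controls that of [Y]
   at [t1 / M]. *)
pose M := (`|x0 - z| + dl)%R.
have M0 : (0 < M)%R by rewrite ltr_wpDl.
have t00 : (0 < t1 / M)%R by rewrite divr_gt0.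
have IY : \int[P]_xi (expR (t1 / M * Y xi))%:E < +oo.
  apply: le_lt_trans It1; apply: ae_ge0_le_integral => //.
  - apply/measurable_EFinP; apply: measurableT_comp => //.
    by apply: measurable_funM => //; exact: measurable_cst.
  - apply/measurable_EFinP; apply: measurableT_comp => //.
    by apply: measurable_funM => //; exact: measurable_cst.
  apply: filterS2 (expF_ae_fin F0) fz => xi h0 hz _.
  rewrite lee_fin ler_expR -mulrA ler_pM2l// ler_pdivrMl//.
  by have := lipg h0 hz; rewrite /Y /M; lra.
have [t t0 It] := exp_moment_lt1 mY iY EY t00 IY.
(* Within radius [dl] the term [dl * kappa] covers the Lipschitz cost. The indicator handles samples
   with a point where [f] is infinite at [z], which are negligible. *)
exists (ball z dl), (fun s => (\prod_(xi <- s) expR (t * Y xi))%:E +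
  (if has (fun xi => ~~ (f xi z < +oo)) s then 1 else 0)).
split.
- exact: ball_open.
- exact: ballxx.
- apply: rareD.
    apply: rare_prod => //.
    apply: measurableT_comp => //.
    by apply: measurable_funM => //; exact: measurable_cst.
  have mn : measurable_fun setT (fun xi => ~~ (f xi z < +oo)) by exact: measurable_neg.
  apply: rare_null => //; apply/aeP0 => //.
  by apply: filterS fz => xi ->.
move=> z' s; rewrite -ball_normE /= => zz' f0 fz' le0.
case: ifPn => [_|]; first by rewrite leeDr// lee_fin prodr_ge0.
rewrite has_predC negbK => fzs; rewrite adde0 lee_fin.
rewrite -(big_morph expR (@expRD R) (@expR0 R)) -expR0 ler_expR -big_distrr/=.
rewrite mulr_ge0 ?(ltW t0)//.
pose p xi := [&& f xi x0 < +oo, f xi z' < +oo & f xi z < +oo].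
have ps : all p s by rewrite !all_predI f0 fz' fzs.
have : (\sum_(xi <- s) (g x0 xi - g z' xi) <= \sum_(xi <- s) Y xi)%R.
  apply: (le_sum_all _ ps) => xi /and3P[_ h' h]; rewrite /Y.
  have := lipg h h'; have : (kappa xi * `|z - z'| <= dl * kappa xi)%R.
    by rewrite mulrC ler_wpM2r// ltW.
  lra.
by apply: le_trans; rewrite sumrB subr_ge0.
Qed.

End saa.

(** * Truncating a segment at a sphere *)

Section localization.
Context {R : realType} {n : nat}.

(** This replaces a possibly distant solution by a point of a fixed ball: the solution itself if it
    lies there, otherwise the point where the segment crosses the sphere. *)
Lemma segment_hits (x0 x : 'rV[R]_n) (r : R) : (0 < r)%R ->
  exists2 t : R, (0 <= t <= 1)%R &
    let z := ((1 - t) *: x0 + t *: x)%R in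
    (`|z - x0| <= r)%R /\ (z = x \/ `|z - x0| = r)%R.
Proof.
move=> r0; have [xr|rx] := leP `|x - x0|%R r.
  by exists 1%R; [lra|rewrite subrr scale0r add0r scale1r; split => //; left].
have nx : (0 < `|x - x0|)%R by exact: lt_trans rx.
exists (r / `|x - x0|)%R.
  by rewrite divr_ge0 ?(ltW r0)//= ler_pdivrMr// mul1r ltW.
set t := (r / _)%R => z.
have -> : (z - x0 = t *: (x - x0))%R.
  by rewrite /z scalerBl scale1r scalerBr addrAC [(x0 - _)%R]addrC addrK addrC.
by rewrite normrZ ger0_norm ?divr_ge0 ?(ltW r0)// divfK ?gt_eqF//; split => //; right.
Qed.

End localization.

(** * Combining localization near the optimal set with the tail bound *)

Unset Implicit Arguments.
Theorem theorem3p5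
  (R : realType) (d : measure_display) (T : measurableType d)
  (P : probability T R) (n m : nat)
  (X : set 'rV[R]_n)
  (f : T -> 'rV[R]_n -> \bar R)
  (c : 'I_m -> 'rV[R]_n -> R) (l : 'I_m -> T -> R)
  (kappa : T -> R)
  (xstar : forall N : nat, N.-tuple T -> 'rV[R]_n)
  (* convex setting *)
  (HXne : X !=set0) (HXcl : closed X) (HXcv : convex_set X)
  (Hfm : forall xi x, f xi x != -oo)
  (Hfcv : forall xi, ext_convex (f xi))
  (Hfmeas : forall x, measurable_fun setT (fun xi => f xi x))
  (HFlow : forall x, -oo < expF P f x)
  (HFfin : exists2 x, X x & expF P f x < +oo)
  (HXs_ne : argmin_on X (expF P f) !=set0)
  (HXs_cpt : compact (argmin_on X (expF P f)))
  (* SAA solutions *)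
  (Hxstar : forall N (s : N.-tuple T), argmin_on X (hatF f s) (xstar N s))
  (Hxstar_meas : forall N, measurable_fun setT (fun s : N.-tuple T => dfeas P f (xstar N s)))
  (* structure of the domains *)
  (Hc : forall k, convex_function setT (c k))
  (Hl : forall k, measurable_fun setT (l k))
  (Hdom : forall xi x, f xi x < +oo <-> (forall k, (c k x <= l k xi)%R))
  (* Lipschitz condition *)
  (Hk0 : forall xi, (0 <= kappa xi)%R)
  (Hkmeas : measurable_fun setT kappa)
  (HkL : P.-integrable setT (EFin \o kappa))
  (Hlip : forall xi x y, f xi x < +oo -> f xi y < +oo ->
     (`|fine (f xi x) - fine (f xi y)| <= kappa xi * `|x - y|)%R)
  (* (C1) and (C3) on every compact subset of dom F *)
  (HC : forall K : set 'rV[R]_n, compact K ->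
     K `<=` [set x | expF P f x < +oo] ->
     (forall x, K x -> exists2 delta : R, (0 < delta)%R &
        forall t : R, (`|t| < delta)%R ->
          \int[P]_xi expeR (t%:E * (f xi x - expF P f x)) < +oo)
     /\ (exists2 delta : R, (0 < delta)%R &
        forall t : R, (`|t| < delta)%R ->
          \int[P]_xi (expR (t * kappa xi))%:E < +oo)) :
  let J := Jset P (argmin_on X (expF P f)) c l in
  exists abar : R, (0 < abar)%R /\
  exists C : R, (0 < C)%R /\ exists beta : R, (0 < beta)%R /\
  forall N : nat, (#|J| <= N)%N ->
  forall alpha : R, (0 <= alpha < abar)%R ->
    prodP P [set s : N.-tuple T | dfeas P f (xstar N s) < (1 - alpha)%:E]
    <= (C * expR (- (N%:R * beta)) +
        \sum_(0 <= k < #|J|) ('C(N, k)%:R * alpha ^+ k * (1 - alpha) ^+ (N - k)))%:E.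
Proof.
move=> J.
have [xb Xs_xb] := HXs_ne.
have [xF XxF FxF] := HFfin.
have FX x : argmin_on X (expF P f) x -> expF P f x < +oo.
  by move=> [_ /(_ _ XxF)] /le_lt_trans; apply.
have Fxb := FX _ Xs_xb.
have Hcc k : continuous (c k) by exact: convex_function_continuous.
have Hexp : exists2 t : R, (0 < t)%R & \int[P]_xi (expR (t * kappa xi))%:E < +oo.
  (* The moment condition on [kappa] does not mention the compact set, so it can be read off at the
     empty one. *)
  have [|_ [dl dl0 Hdl]] := HC set0 (@compact0 _); first by [].
  exists (dl / 2)%R; first exact: divr_gt0.
  by apply: Hdl; rewrite ger0_norm ?divr_ge0 ?(ltW dl0)//; lra.
pose q k := quantile P (l k) 0.
have aefin x : expF P f x < +oo -> {ae P, forall xi, f xi x < +oo}.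
  exact: expF_ae_fin.
(* An optimal point is almost surely feasible, so [c k x] is at most the essential infimum; equality
   would put [k] in [J]. *)
have cq k x : k \notin J -> argmin_on X (expF P f) x -> (c k x)%:E < q k.
  move=> kJ Xsx; rewrite lt_neqAle; apply/andP; split.
    apply/eqP => ckx; move: kJ; rewrite inE => /asboolP; apply.
    by exists x.
  apply: quantile0_ge => //; apply: filterS (aefin _ (FX _ Xsx)) => xi fx.
  exact: (Hdom xi x).1.
have [r r0 Xs_r] : exists2 r : R, (0 < r)%R &
    forall x, argmin_on X (expF P f) x -> (`|x - xb| < r)%R.
  have [M [Mreal HM]] := compact_bounded HXs_cpt.
  exists (`|M| + 1 + `|xb| + 1)%R; first by rewrite ltr_wpDl// !addr_ge0.
  move=> x Xsx; rewrite (le_lt_trans (ler_normB _ _))//.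
  have xM : (`|x| <= `|M| + 1)%R.
    by apply: HM Xsx; rewrite (le_lt_trans (ler_norm M))// ltrDl.
  lra.
(* An open neighbourhood of the optimal set on which the constraints outside [J] hold almost
   surely. *)
pose W := [set x : 'rV[R]_n | (forall k, k \notin J -> (c k x)%:E < q k) /\ (`|x - xb| < r)%R].
have oW : open W.
  rewrite openE => x [Wx xr]; rewrite /interior.
  have h1 : \forall y \near x, (`|y - xb| < r)%R.
    have : open (ball xb r) by exact: ball_open.
    rewrite openE => /(_ x); rewrite /interior -ball_normE /= distrC => /(_ xr).
    by apply: filterS => y; rewrite /= distrC.
  have h2 : \forall y \near x, forall k, k \notin J -> (c k y)%:E < q k.
    apply: (near_forall_fin (FF := nbhs_filter x)) => k.
    have [kJ|kJ] := boolP (k \in J); first by apply: (filterS _ h1).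
    have : open [set t : R | t%:E < q k] by exact: open_ereal_lt.
    rewrite openE => /(_ _ (Wx _ kJ)) h.
    have hn : nbhs x (c k @^-1` [set t | t%:E < q k]) := Hcc k x _ h.
    by apply: filterS hn.
  by apply: filterS2 h1 h2.
(* [S] contains no optimal point, so [F] is larger there than at [xb]. *)
pose S := X `&` closed_ball xb r `&` ~` W.
have cS : compact S.
  apply: bounded_closed_compact.
    exists (`|xb| + r)%R; split; first exact: num_real.
    move=> M hM z [[_]]; rewrite closed_ballE// /closed_ball_/= => zr _.
    have := ler_normB xb (xb - z)%R; rewrite subKr; lra.
  apply: closedI; last exact: open_closedC.
  by apply: closedI => //; exact: closed_ball_closed.
have S_excl z : exists p : set 'rV[R]_n * (seq T -> \bar R), rare P p.2 /\
   (S z -> [/\ open p.1, p.1 z & forall z' s, p.1 z' ->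
    all (fun xi => f xi xb < +oo) s -> all (fun xi => f xi z' < +oo) s ->
    (\sum_(xi <- s) fine (f xi z') <= \sum_(xi <- s) fine (f xi xb))%R -> 1 <= p.2 s]).
  (* The dummy pair outside [S] makes the statement total, as [choice] requires. *)
  have [Sz|nSz] := pselect (S z); last by exists (set0, fun=> 0); split => //; exact: rare0.
  have zlt : expF P f xb < expF P f z.
    rewrite lt_neqAle (Xs_xb.2 _ Sz.1.1) andbT; apply/eqP => E.
    have Xsz : argmin_on X (expF P f) z.
      by split; [exact: Sz.1.1|move=> y Xy; rewrite -E; exact: Xs_xb.2].
    by apply: Sz.2; split; [move=> k kJ; exact: cq|exact: Xs_r].
  have [U [h [oU Uz rh Hh]]] := local_exclusion Hfm Hfmeas HFlow Hk0 Hkmeas HkL Hlip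
     Hcc Hl Hdom Hexp Fxb zlt.
  by exists (U, h).
have [p Hp] := choice S_excl.
have [Df DfS SDf] : finite_subset_cover S (fun z => (p z).1) S.
  have := cS; rewrite compact_cover; apply; first by move=> z /(Hp z).2[].
  by move=> z Sz; exists z => //; have [] := (Hp z).2 Sz.
pose h0 := fun s : seq T => if has (fun xi => ~~ (f xi xb < +oo)) s then 1 else 0 : \bar R.
(* When [H s < 1], [xb] is feasible for the whole sample and no sample-feasible point of [S] does as
   well as [xb]. *)
pose H s := \sum_(z <- finmap.enum_fset Df) (p z).2 s + h0 s.
have rareH : rare P H.
  apply: rareD; first by apply: rare_sum => z; exact: (Hp z).1.
  have mfin : measurable_fun setT (fun xi => f xi xb < +oo).
    by apply: measurable_fun_lte => //; exact: measurable_cst.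
  have mn : measurable_fun setT (fun xi => ~~ (f xi xb < +oo)) by exact: measurable_neg.
  apply: rare_null => //; apply/aeP0 => //.
  by apply: filterS (aefin _ Fxb) => xi ->.
have sum_ge0 s : 0 <= \sum_(z <- finmap.enum_fset Df) (p z).2 s.
  by apply: sume_ge0 => z _; case: (Hp z).1.
have h0_ge0 s : 0 <= h0 s by rewrite /h0; case: ifP.
have localized N (s : N.-tuple T) : H s < 1 ->
    all (fun xi => f xi (xstar N s) < +oo) s /\ W (xstar N s).
  move=> Hs.
  have fxb : all (fun xi => f xi xb < +oo) s.
    apply: contraLR Hs => /negbTE nf; rewrite -leNgt /H /h0 has_predC nf /=.
    exact: leeDr.
  have [Xx xopt] := Hxstar N s.
  have [fx xle] := hatF_le Hfm fxb (xopt _ Xs_xb.1).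
  split => //; apply: contrapT => nWx.
  have [t t01 [zr zE]] := segment_hits xb (xstar N s) r0.
  have [fz zle] := segment_improves Hfm Hfcv t01 fxb fx xle.
  set z := ((1 - t) *: xb + t *: xstar N s)%R in zr zE fz zle.
  have Sz : S z.
    split; first split.
    - exact: (convex_setP HXcv Xs_xb.1 Xx t01).
    - by rewrite closed_ballE// /closed_ball_/= distrC.
    (* Either [z] is the solution, assumed outside [W], or it lies on the sphere of radius [r],
       which [W] avoids. *)
    - by case: zE => [->//|zE] [_]; rewrite zE ltxx.
  have [y /= yD pyz] := SDf _ Sz.
  move: Hs; apply/negP; rewrite -leNgt.
  have Sy : S y by have := DfS _ yD; rewrite inE.
  have [_ _ /(_ _ _ pyz fxb fz zle) /le_trans] := (Hp y).2 Sy; apply.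
  rewrite /H (big_rem y)//= -addeA leeDl//.
  apply: adde_ge0 => //; apply: sume_ge0 => y' _.
  by case: (Hp y').1.
(* Almost every point is feasible for the solution or breaks a constraint of [J]; in the latter case
   it lies strictly below all sampled levels. *)
have feas N (s : N.-tuple T) : H s < 1 ->
    1 <= dfeas P f (xstar N s) + viol P l (fun=> 1%R) (enum J) s.
  move=> /localized[fx [Wx _]].
  set x := xstar N s in fx Wx *.
  have mf : measurable_fun setT (fun xi => f xi x < +oo).
    by apply: measurable_fun_lte => //; exact: measurable_cst.
  have mv := measurable_violated_seq Hl (enum J) s.
  rewrite /dfeas -integral_pred// /viol -ge0_integralD//; first last.
  - by apply/measurable_EFinP; apply: measurable_fun_ifT.
  - by move=> xi _; case: ifP.
  - by apply/measurable_EFinP; apply: measurable_fun_ifT.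
  - by move=> xi _; case: ifP.
  have <- : \int[P]_xi 1 = 1 by rewrite (integral_cst P measurableT 1) mul1e; exact: probability_setT.
  apply: ae_ge0_le_integral => //.
  - by move=> xi _; apply: adde_ge0; case: ifP.
  - by apply: emeasurable_funD; apply/measurable_EFinP; apply: measurable_fun_ifT.
  have : {ae P, forall xi, forall k, k \notin J -> (c k x < l k xi)%R}.
    apply: near_forall_fin => k; have [kJ|kJ] := boolP (k \in J); first exact: aeW.
    by apply: filterS (ae_quantile0 (Hl k) (Wx k kJ)).
  apply: filterS => xi Hxi _.
  case: ifPn => [_|nf]; first by apply: leeDl; case: ifP.
  rewrite ifT ?add0e//; apply/hasP.
  have [k ck] : exists k, ~ (c k x <= l k xi)%R.
    by apply/existsNP; apply: contraNnot nf => /(Hdom xi x).2.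
  have kJ : k \in J by apply: contraPT ck => /Hxi /ltW ckl; exact.
  exists k; first by rewrite mem_enum.
  apply: sub_all fx => xi' /(Hdom xi' x).1 /(_ k); apply: lt_le_trans.
  by rewrite ltNge; apply/negP.
have [H0 mH [theta [C [/andP[th0 th1] C0 HB]]]] := rareH.
(* The tail bound at total mass [1] covers all [alpha < 1]. Adding [1] makes the constant positive,
   and [- ln theta] turns [theta ^+ N] into the required exponential. *)
exists 1%R; split; first exact: ltr01.
exists (C + 1)%R; split; first exact: ltr_wpDl.
exists (- ln theta)%R; split; first by rewrite oppr_gt0 ln_lt0// th0.
move=> N _ alpha /andP[a0 a1].
have thE : (expR (- (N%:R * - ln theta)) = theta ^+ N)%R.
  by rewrite mulrN opprK expRM_natl lnK.
rewrite thE.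
pose V := viol_gt P l (fun=> 1%R) (enum J) alpha.
have V0 s : 0 <= V s by exact: viol_gt_ge0.
have mV : seq_measurable V by exact: seq_measurable_viol_gt.
apply: (@le_trans _ _ (wint P (fun=> 1%R) N (fun s => H s + V s))).
  apply: le_prodP_wint; first by move=> s; exact: adde_ge0.
  (* Unless [1 <= H s], a degree of feasibility below [1 - alpha] forces a violated mass above
     [alpha]. *)
  move=> s /= ds; have [Hs|Hs] := leP 1 (H s); first exact: (le_trans Hs (leeDl _ _)).
  apply: (@le_trans _ _ (V s)); last exact: leeDr.
  rewrite /V /viol_gt ifT// ltNge; apply/negP => va.
  have := feas N s Hs; apply/negP; rewrite -ltNge.
  have -> : 1 = (1 - alpha)%:E + alpha%:E by rewrite -EFinD subrK.
  apply: lte_leD => //.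
  have v0 : 0 <= viol P l (fun=> 1%R) (enum J) s.
    by apply: integral_ge0 => xi _; rewrite lee_fin; case: ifP.
  by rewrite ge0_fin_numE// (le_lt_trans va)// ltry.
rewrite wintD// EFinD leeD//.
  by rewrite (le_trans (HB N))// lee_fin ler_wpM2r ?exprn_ge0 ?(ltW th0)// lerDl.
have := @scenario_bound _ _ _ P _ l Hl (enum J) (fun=> 1%R) N alpha 1%R.
rewrite /binomial_tail -cardE; apply => //.
- by rewrite (integral_cst P measurableT 1) mul1e; exact: probability_setT.
- by rewrite a0.
Qed.
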